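(* Let $0<\varepsilon\le1$ and $\gamma$ be constants, $s$ an integer with $|s|\le(1-\varepsilon)n$, and $F$ a deterministic complex $n\times n$ matrix with rows $\mathbf f_1,\dots,\mathbf f_n$ and entries of modulus at most $n^\gamma$. Let $X_n$ be a random matrix whose rows $\mathbf x_1,\dots,\mathbf x_n$ are independent random vectors sampled uniformly from the set $\mathcal S$ of vectors in $\{-1,1\}^n$ with coordinate sum $s-1$ or $s+1$. Then for any $B>0$, $$\mathbb P\big(\mathbf x_1+\mathbf f_1\text{ belongs to the subspace }H\text{ generated by }\mathbf x_2+\mathbf f_2,\dots,\mathbf x_n+\mathbf f_n\big)=O(n^{-B}),$$ where the implied constant depends on $B$. *)

(* Defs.v *)
From HB Require Import structures.
From mathcomp Require Import all_boot all_order all_algebra.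
From mathcomp Require Import reals exp.
From mathcomp Require Export complex.
Set Implicit Arguments. Unset Strict Implicit. Unset Printing Implicit Defensive.
Import Order.TTheory GRing.Theory Num.Theory.
Local Open Scope ring_scope.

(* A sign vector in {-1,1}^m is encoded by a boolean vector: true ~ 1, false ~ -1. *)
Definition sgnb (T : pzRingType) (b : bool) : T := if b then 1 else -1.

Definition coord_sum m (v : {ffun 'I_m -> bool}) : int := \sum_(j < m) sgnb int (v j).

Definition Sset m (s : int) : {set {ffun 'I_m -> bool}} :=
  [set v | (coord_sum v == s - 1) || (coord_sum v == s + 1)].

Definition brow m (X : 'M[bool]_m) (i : 'I_m) : {ffun 'I_m -> bool} := [ffun j => X i j].

Definition pm_mx (T : pzRingType) m (X : 'M[bool]_m) : 'M[T]_m := map_mx (sgnb T) X.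

Definition first_row_in_span_rest (K : fieldType) k (Y : 'M[K]_(k.+1)) : bool :=
  (row 0 Y <= row' 0 Y)%MS.

(* Probability, when the rows x_1..x_m of X are independent and uniform on S
   (i.e. X is uniform on S^m), that x_1+f_1 lies in span(x_2+f_2,...,x_m+f_m). *)
Definition prob_event (R : realType) k (s : int) (F : 'M[R[i]]_(k.+1)) : R :=
  #|[set X : 'M[bool]_(k.+1) |
      [forall i, brow X i \in Sset (k.+1) s]
      && first_row_in_span_rest (pm_mx R[i] X + F)]|%:R
  / (#|Sset (k.+1) s| ^ k.+1)%:R.

(* Main.v *)
Require Import Defs.
From HB Require Import structures.
From mathcomp Require Import all_boot all_order all_algebra all_fingroup.
From mathcomp Require Import boolp.
From mathcomp Require Import reals exp.
From mathcomp Require Import complex.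
From mathcomp Require Import ring lra zify.
Set Implicit Arguments. Unset Strict Implicit. Unset Printing Implicit Defensive.
Import Order.TTheory GRing.Theory Num.Theory.
Local Open Scope ring_scope.

(** Let S be the set of sign vectors with coordinate sum s-1 or s+1, and for a
vector v let rho(v) be the largest atom of x.v, x uniform on S.  If the rows
i <> 0 have a nonzero null vector v with rho(v) small, then row 0 is in their
span with probability at most rho(v); so it suffices to exclude null vectors
with rho(v) not too small.

For such a v, with most likely value c, pick a random pair (x,y): x uniform on
S, y obtained from x by resampling a random half of the coordinates within the
layer of x.  The conditional law of x.v given the retained half has smaller
variance on {x.v = c} than overall, and a chi-square estimate turns this into
P(x.v = y.v = c) >= (1+g) rho(v)^2 for a constant g > 0.  An Odlyzko-type
estimate shows that x and y are also linearly independent modulo any fixed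
space of relations of large codimension, up to a negligible probability.
Hence T nearly n/2 independent pairs cut out a random space of dimension D much
smaller than n which contains (v,-c) with probability about
((1+g) rho(v)^2)^T, while a fixed D-dimensional space contains a null vector of
the n-1 random rows with probability at most n^D rho(v)^(n-1-D): D rows
determine the vector, and the others are independent of it.  Averaging over the
random space, the quotient (1+g)^(-T) n^D rho(v)^(-2) bounds the probability
that such a v exists. *)

(** * Moments and conditional second moments *)

Section ExchangeablePair.
Variables (R : realFieldType) (Om I : finType) (E : {set Om}).
Variables (s : I -> Om -> Om) (D : I -> Om -> R) (r : Om -> R) (th : R).
Hypothesis s_inv : forall a o, s a (s a o) = o.
Hypothesis s_dom : forall a o, o \in E -> s a o \in E.
Hypothesis rE : forall o, r o = th * \sum_a D a o.
Hypothesis r_s : forall a o, r (s a o) = r o - D a o.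
Hypothesis D_s : forall a o, D a (s a o) = - D a o.

Lemma sum_involution a (f : Om -> R) : \sum_(o in E) f (s a o) = \sum_(o in E) f o.
Proof.
have inj : injective (s a) by apply: (can_inj (s_inv a)).
rewrite [RHS](reindex_onto (s a) (s a)) /=; last by move=> o _; exact: s_inv.
apply: eq_bigl => o; rewrite s_inv eqxx andbT.
apply/idP/idP => [|/(s_dom a)]; first exact: s_dom.
by rewrite s_inv.
Qed.

(** Average the sum with its image under the involution [s a], which turns [D a] into [- D a] and
    [r] into [r - D a]. *)
Lemma exchange_sum a (f : R -> R) :
  \sum_(o in E) D a o * f (r o)
  = 2^-1 * \sum_(o in E) D a o * (f (r o) - f (r o - D a o)).
Proof.
have e : \sum_(o in E) D a o * f (r o) = - \sum_(o in E) D a o * f (r o - D a o).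
  rewrite -(sum_involution a) -sumrN; apply: eq_bigr => o _.
  by rewrite D_s r_s mulNr.
under [in RHS]eq_bigr do rewrite mulrBr.
by rewrite sumrB -[X in _ - X]opprK -e; field.
Qed.

Lemma sum_mul_exchange (f : R -> R) :
  \sum_(o in E) r o * f (r o)
  = th / 2 * \sum_a \sum_(o in E) D a o * (f (r o) - f (r o - D a o)).
Proof.
under eq_bigr do rewrite {1}rE -mulrA mulr_suml.
rewrite -mulr_sumr exchange_big /=.
under eq_bigr do rewrite exchange_sum.
by rewrite -mulr_sumr mulrA.
Qed.

Lemma sum_exchange0 : \sum_(o in E) r o = 0.
Proof.
transitivity (\sum_(o in E) r o * (fun=> 1) (r o)).
  by apply: eq_bigr => o _; rewrite mulr1.
rewrite (sum_mul_exchange (fun=> 1)) big1 ?mulr0 // => a _.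
by rewrite big1 // => o _; rewrite subrr mulr0.
Qed.

Lemma sum_exchange2 :
  \sum_(o in E) r o ^+ 2 = th / 2 * \sum_a \sum_(o in E) D a o ^+ 2.
Proof.
transitivity (\sum_(o in E) r o * (fun x => x) (r o)).
  by apply: eq_bigr => o _; rewrite expr2.
rewrite (sum_mul_exchange (fun x => x)); congr (_ * _); apply: eq_bigr => a _.
by apply: eq_bigr => o _; ring.
Qed.

(** The exchange identity with f(x) = x^3: D (x^3 - (x - D)^3) is at most 3/2 D^2 (x^2 + (x - D)^2),
    and the involution shows that both squares have the same sum when weighted by D^2. *)
Lemma sum_exchange4 (b : I -> R) : 0 <= th -> (forall a o, D a o ^+ 2 <= b a) ->
  \sum_(o in E) r o ^+ 4 <= 3 * th / 2 * (\sum_a b a) * \sum_(o in E) r o ^+ 2.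
Proof.
move=> th0 Db.
have -> : \sum_(o in E) r o ^+ 4 = \sum_(o in E) r o * (fun x => x ^+ 3) (r o).
  by apply: eq_bigr => o _; ring.
rewrite (sum_mul_exchange (fun x => x ^+ 3)).
have -> : 3 * th / 2 * (\sum_a b a) * (\sum_(o in E) r o ^+ 2)
  = th / 2 * \sum_a (3 * b a * \sum_(o in E) r o ^+ 2).
  by rewrite -mulr_suml -mulr_sumr; ring.
apply: ler_wpM2l; first by rewrite divr_ge0.
apply: ler_sum => a _.
apply: (@le_trans _ _ (\sum_(o in E) (3 / 2 * D a o ^+ 2 * (r o ^+ 2 + (r o - D a o) ^+ 2)))).
  apply: ler_sum => o _; set x := r o; set d := D a o.
  rewrite -subr_ge0.
  have -> : 3 / 2 * d ^+ 2 * (x ^+ 2 + (x - d) ^+ 2) - d * (x ^+ 3 - (x - d) ^+ 3)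
    = d ^+ 2 * (d ^+ 2 / 2) by field.
  by rewrite mulr_ge0 ?divr_ge0 ?sqr_ge0.
have e : \sum_(o in E) D a o ^+ 2 * (r o - D a o) ^+ 2 = \sum_(o in E) D a o ^+ 2 * r o ^+ 2.
  rewrite -(sum_involution a); apply: eq_bigr => o _.
  by rewrite D_s r_s; ring.
under eq_bigr do rewrite -mulrA mulrDr.
rewrite -mulr_sumr big_split /= e.
have -> (x : R) : 3 / 2 * (x + x) = 3 * x by field.
rewrite -mulrA ler_pM2l // mulr_sumr; apply: ler_sum => o _.
by rewrite ler_wpM2r ?sqr_ge0.
Qed.
End ExchangeablePair.

(** * Conditional probabilities given a key *)

Section ConditionalSecondMoment.
Variables (R : realFieldType) (Om : finType) (Key : eqType) (key : Om -> Key).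
Variables (E A : {set Om}).
Hypothesis AE : A \subset E.

Definition keyclass (o : Om) := [set o' in E | key o' == key o].
Definition condprob (o : Om) : R := #|A :&: keyclass o|%:R / #|keyclass o|%:R.

Lemma keyclass_eq o o' : key o = key o' -> keyclass o = keyclass o'.
Proof. by move=> e; apply/setP => x; rewrite !inE e. Qed.

Lemma condprob_eq o o' : key o = key o' -> condprob o = condprob o'.
Proof. by move=> e; rewrite /condprob (keyclass_eq e). Qed.

(** Tower property: [f] is constant on key classes, so the conditional probability of [A] may be
    replaced by the indicator of [A]. *)
Lemma sum_condprob (f : Om -> R) : (forall o o', key o = key o' -> f o = f o') ->
  \sum_(o in E) f o * condprob o = \sum_(o in A) f o.
Proof.
move=> fk.
have eqA o : o \in E -> f o * condprob o =
    \sum_(o' in A) (if o \in keyclass o' then f o' / #|keyclass o'|%:R else 0).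
  move=> oE; rewrite /condprob -sum1_card natr_sum mulr_suml mulr_sumr.
  rewrite [RHS]big_mkcond /= [LHS]big_mkcond /=; apply: eq_bigr => o' _.
  rewrite !inE; case: (boolP (o' \in A)) => //= o'A.
  rewrite (subsetP AE _ o'A) oE /= eq_sym; case: eqP => // e.
  by rewrite mul1r (fk _ _ e) (keyclass_eq e).
rewrite (eq_bigr _ eqA) exchange_big /=; apply: eq_bigr => o' o'A.
have o'E := subsetP AE _ o'A.
rewrite -big_mkcondr /=.
rewrite (eq_bigl (mem (keyclass o'))); last by move=> o; rewrite !inE andbA andbb.
rewrite sumr_const -[LHS]mulr_natr mulfVK //.
by rewrite pnatr_eq0 -lt0n; apply/card_gt0P; exists o'; rewrite inE o'E /=.
Qed.

(* chi-square divergence of the conditional law given [A] against a test function *)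
Lemma sum_condprob_ge (f : Om -> R) (De V : R) :
  (forall o o', key o = key o' -> f o = f o') ->
  (0 < #|E|)%N -> 0 < V ->
  \sum_(o in E) f o = 0 -> \sum_(o in A) f o = #|A|%:R * De ->
  \sum_(o in E) f o ^+ 2 <= #|E|%:R * V ->
  #|A|%:R ^+ 2 / #|E|%:R * (1 + De ^+ 2 / V) <= \sum_(o in A) condprob o.
Proof.
move=> fk E0 V0 f0 fA f2.
have EE : 0 < #|E|%:R :> R by rewrite ltr0n.
pose p : R := #|A|%:R / #|E|%:R; pose l := De / V.
have gk := condprob_eq.
(* Expand the squared residual of [condprob] after regression on 1 and [f]; the slope [l = De / V]
   makes the resulting lower bound largest. *)
have : 0 <= \sum_(o in E) (condprob o - p - p * l * f o) ^+ 2.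
  by apply: sumr_ge0 => o _; rewrite sqr_ge0.
have -> : \sum_(o in E) (condprob o - p - p * l * f o) ^+ 2
  = \sum_(o in E) condprob o * condprob o - 2 * p * \sum_(o in E) 1 * condprob o
    - 2 * p * l * (\sum_(o in E) f o * condprob o) + \sum_(o in E) p ^+ 2
    + 2 * p ^+ 2 * l * (\sum_(o in E) f o) + p ^+ 2 * l ^+ 2 * (\sum_(o in E) f o ^+ 2).
  rewrite !mulr_sumr -!sumrN -!big_split /=; apply: eq_bigr => o _; ring.
rewrite (sum_condprob gk) (sum_condprob fk) (@sum_condprob (fun=> 1)) // f0 fA.
rewrite !sumr_const -[p ^+ 2 *+ _]mulr_natr.
set Q := \sum_(o in A) _; set F := \sum_(o in E) _ => h.
have hF : p ^+ 2 * l ^+ 2 * F <= p ^+ 2 * l ^+ 2 * (#|E|%:R * V).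
  by apply: ler_wpM2l => //; rewrite mulr_ge0 ?sqr_ge0.
have e : #|A|%:R ^+ 2 / #|E|%:R * (1 + De ^+ 2 / V) =
   2 * p * #|A|%:R + 2 * p * l * (#|A|%:R * De) - p ^+ 2 * #|E|%:R
    - 2 * p ^+ 2 * l * 0 - p ^+ 2 * l ^+ 2 * (#|E|%:R * V).
  by rewrite /p /l; field; rewrite !gt_eqF.
rewrite e; lra.
Qed.
End ConditionalSecondMoment.

Section SignSums.
Variables (R : realFieldType) (I : finType).
Local Notation sg X i := (sgnb R (i \in X)).

Lemma sgnb_sqr (b : bool) : sgnb R b ^+ 2 = 1.
Proof. by case: b; rewrite /sgnb ?sqrrN expr1n. Qed.

Lemma sum_setX (S T : finType) (A : {set S}) (B : {set T}) (f : S -> T -> R) :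
  \sum_(p in setX A B) f p.1 p.2 = \sum_(i in A) \sum_(j in B) f i j.
Proof. by rewrite pair_big; apply: eq_bigl => -[x y]; rewrite in_setX. Qed.

(** * Independent signs: the exchange flips one coordinate *)

Section Rademacher.
Variable u : I -> R.
Let r (J : {set I}) := \sum_i sg J i * u i.
Let s (i : I) (J : {set I}) := [set x | (x \in J) (+) (x == i)].
Let D (i : I) (J : {set I}) := 2 * (sg J i * u i).

Let s_inv a o : s a (s a o) = o.
Proof. by apply/setP => x; rewrite !inE addbK. Qed.

Let s_dom a o : o \in [set: {set I}] -> s a o \in [set: {set I}].
Proof. by rewrite !inE. Qed.

Let rE o : r o = 2^-1 * \sum_a D a o.
Proof. by rewrite -mulr_sumr mulKf ?pnatr_eq0. Qed.

Let D_s a o : D a (s a o) = - D a o.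
Proof. by rewrite /D /s inE eqxx; case: (a \in o) => /=; rewrite /sgnb; ring. Qed.

Let r_s a o : r (s a o) = r o - D a o.
Proof.
rewrite /r (bigD1 a) //= [in RHS](bigD1 a) //= [D _ _]/D.
rewrite [X in _ + X](eq_bigr (fun i => sg o i * u i)).
  by rewrite /s inE eqxx; case: (a \in o) => /=; rewrite /sgnb; ring.
by move=> i /negbTE ia; rewrite /s inE ia addbF.
Qed.

Let N : R := (2 ^ #|I|)%:R.

Lemma card_set_setT : #|[set: {set I}]| = (2 ^ #|I|)%N.
Proof. by rewrite -powersetT card_powerset cardsT. Qed.

Lemma rademacher1 : \sum_J r J = 0.
Proof.
apply: etrans (sum_exchange0 s_inv s_dom rE r_s D_s).
by apply: eq_bigl => J; rewrite inE.
Qed.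

Lemma rademacher2 : \sum_J r J ^+ 2 = N * \sum_i u i ^+ 2.
Proof.
transitivity (\sum_(J in [set: {set I}]) r J ^+ 2).
  by apply: eq_bigl => J; rewrite inE.
rewrite (sum_exchange2 s_inv s_dom rE r_s D_s).
rewrite !mulr_sumr; apply: eq_bigr => i _.
under eq_bigr do rewrite /D 2!exprMn sgnb_sqr mul1r.
by rewrite sumr_const card_set_setT -mulr_natr /N; field.
Qed.

Lemma rademacher4 : \sum_J r J ^+ 4 <= 3 * N * (\sum_i u i ^+ 2) ^+ 2.
Proof.
have Db a o : D a o ^+ 2 <= 4 * u a ^+ 2.
  by rewrite /D 2!exprMn sgnb_sqr mul1r -natrX lexx.
have h0 : 0 <= 2^-1 :> R by rewrite invr_ge0 ler0n.
have := sum_exchange4 s_inv s_dom rE r_s D_s h0 Db.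
have e (f : {set I} -> R) : \sum_(J in [set: {set I}]) f J = \sum_J f J.
  by apply: eq_bigl => J; rewrite inE.
rewrite !e rademacher2 -mulr_sumr => /le_trans; apply.
by rewrite le_eqVlt; apply/orP; left; apply/eqP; field.
Qed.
End Rademacher.

(** * Sign vectors with a fixed number of plus signs: the exchange transposes two coordinates *)

Section Slice.
Variables (k : nat) (w : I -> R).
Hypothesis w0 : \sum_i w i = 0.
Hypothesis I0 : (0 < #|I|)%N.
Let n : R := #|I|%:R.
Definition slice : {set {set I}} := [set X : {set I} | #|X| == k].
Let z (X : {set I}) := \sum_i sg X i * w i.
Let s (p : I * I) (X : {set I}) := tperm p.1 p.2 @^-1: X.
Let D (p : I * I) (X : {set I}) := (w p.1 - w p.2) * (sg X p.1 - sg X p.2).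
Let q := \sum_i w i ^+ 2.

Let n_gt0 : 0 < n. Proof. by rewrite ltr0n. Qed.

Let s_inv a o : s a (s a o) = o.
Proof. by apply/setP => x; rewrite !inE tpermK. Qed.

Let s_dom a o : o \in slice -> s a o \in slice.
Proof. by rewrite !inE card_preimset //; apply: perm_inj. Qed.

Lemma sum_sg (X : {set I}) : \sum_i sg X i = 2 * #|X|%:R - n.
Proof.
transitivity (\sum_i (2 * (i \in X)%:R - 1 : R)).
  by apply: eq_bigr => i _; case: (i \in X); rewrite /sgnb /= ?mulr1 ?mulr0; lra.
rewrite sumrB -mulr_sumr sumr_const -/n; congr (_ * _ - _).
by rewrite -natr_sum -sum1_card [in RHS]big_mkcond /=; congr _%:R; apply: eq_bigr => i _; case: (i \in X).
Qed.

Let sum_diff (f g : I -> R) :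
  \sum_(p : I * I) (f p.1 - f p.2) * (g p.1 - g p.2)
  = 2 * n * (\sum_i f i * g i) - 2 * (\sum_i f i) * (\sum_i g i).
Proof.
rewrite -(pair_bigA _ (fun i j => (f i - f j) * (g i - g j))) /=.
have e i : \sum_j (f i - f j) * (g i - g j) =
   n * (f i * g i) - f i * (\sum_j g j) - g i * (\sum_j f j) + \sum_j f j * g j.
  transitivity (\sum_j (f i * g i - f i * g j - g i * f j + f j * g j)).
    by apply: eq_bigr => j _; ring.
  by rewrite !big_split /= !sumrN -!mulr_sumr sumr_const -[g i *+ _]mulr_natr -/n; ring.
under eq_bigr do rewrite e.
rewrite !big_split /= !sumrN -!mulr_sumr -!mulr_suml sumr_const -mulr_natl -/n.
ring.
Qed.

(** As [w] has sum 0, the double sum over pairs collapses to 2 n z, which is the linearity required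
    by the exchange argument. *)
Let zE o : z o = (2 * n)^-1 * \sum_a D a o.
Proof.
rewrite /D (sum_diff w (fun i => sg o i)) w0 mulr0 mul0r subr0 mulKf ?mulf_neq0 ?gt_eqF //.
by apply: eq_bigr => i _; rewrite mulrC.
Qed.

Let D_s a o : D a (s a o) = - D a o.
Proof. by case: a => i j; rewrite /D /s /= !inE tpermL tpermR; ring. Qed.

Let z_s a o : z (s a o) = z o - D a o.
Proof.
case: a => i j; rewrite /D /s /=; case: (eqVneq i j) => [->|ij].
  rewrite subrr mul0r subr0; apply: eq_bigr => x _.
  by rewrite inE tperm1 perm1.
rewrite /z (bigD1 i) //= (bigD1 j) 1?eq_sym //= [in RHS](bigD1 i) //= [in RHS](bigD1 j) 1?eq_sym //=.
rewrite !inE tpermL tpermR.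
have -> : \sum_(x | (x != i) && (x != j)) sg (tperm i j @^-1: o) x * w x
    = \sum_(x | (x != i) && (x != j)) sg o x * w x.
  by apply: eq_bigr => x /andP[xi xj]; rewrite inE tpermD // eq_sym.
by ring.
Qed.

Lemma slice1 : \sum_(X in slice) z X = 0.
Proof. exact: (sum_exchange0 s_inv s_dom zE z_s D_s). Qed.

Let Db a o : D a o ^+ 2 <= 4 * (w a.1 - w a.2) ^+ 2.
Proof.
rewrite exprMn mulrC; apply: ler_wpM2r; first exact: sqr_ge0.
by case: (a.1 \in o); case: (a.2 \in o); rewrite /sgnb /=; nra.
Qed.

Let sum_b : \sum_(a : I * I) 4 * (w a.1 - w a.2) ^+ 2 = 8 * n * q.
Proof.
rewrite -mulr_sumr; under eq_bigr do rewrite expr2.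
rewrite (sum_diff w w) w0 mulr0 subr0 /q; under [in RHS]eq_bigr do rewrite expr2.
ring.
Qed.

Lemma slice2_le : \sum_(X in slice) z X ^+ 2 <= 2 * q * #|slice|%:R.
Proof.
rewrite (sum_exchange2 s_inv s_dom zE z_s D_s).
apply: (@le_trans _ _ ((2 * n)^-1 / 2 * \sum_(a : I * I) (4 * (w a.1 - w a.2) ^+ 2) * #|slice|%:R)).
  apply: ler_wpM2l; first by rewrite divr_ge0 // invr_ge0 mulr_ge0 // ltW.
  apply: ler_sum => a _; rewrite mulr_natr -sumr_const; apply: ler_sum => o _; exact: Db.
rewrite -mulr_suml sum_b le_eqVlt; apply/orP; left; apply/eqP; field.
by rewrite gt_eqF.
Qed.

Lemma slice4_le : \sum_(X in slice) z X ^+ 4 <= 12 * q ^+ 2 * #|slice|%:R.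
Proof.
have th0 : 0 <= (2 * n)^-1 by rewrite invr_ge0 mulr_ge0 // ltW.
have := sum_exchange4 s_inv s_dom zE z_s D_s th0 Db.
rewrite sum_b => /le_trans; apply.
have -> : 3 * (2 * n)^-1 / 2 * (8 * n * q) = 6 * q by field; rewrite gt_eqF.
have q0 : 0 <= q by apply: sumr_ge0 => i _; exact: sqr_ge0.
have -> : 12 * q ^+ 2 * #|slice|%:R = 6 * q * (2 * q * #|slice|%:R) by ring.
by apply: ler_wpM2l slice2_le; rewrite mulr_ge0.
Qed.

Let F i j := \sum_(X in slice) (sg X i - sg X j) ^+ 2.

Let F_tperm a b i j : F (tperm a b i) (tperm a b j) = F i j.
Proof.
have si := s_inv (a, b); have inj : injective (s (a, b)) := can_inj si.
rewrite /F [RHS](reindex_onto (s (a, b)) (s (a, b))) /=; last by move=> o _; exact: si.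
apply: eq_big => [o|o _]; last by rewrite /s !inE.
rewrite si eqxx andbT; apply/idP/idP => [|/(s_dom (a, b))]; first exact: s_dom.
by rewrite si.
Qed.

Let F_const i j i' j' : i != j -> i' != j' -> F i j = F i' j'.
Proof.
move=> ij ij'; rewrite -(F_tperm i i') tpermL.
set j1 := tperm i i' j.
have j1i : j1 != i' by rewrite -(tpermL i i') (inj_eq perm_inj) eq_sym.
by rewrite -(F_tperm j1 j') tpermL tpermD // eq_sym.
Qed.

(** Invariance under transpositions gives [F i j] one value tau for all i <> j. The total of [F]
    over the at most n^2 such pairs bounds tau from below, and the exchange identity expresses the
    second moment through tau. *)
Lemma slice2_ge : 4 * k%:R * (n - k%:R) * q * #|slice|%:R <= n ^+ 2 * \sum_(X in slice) z X ^+ 2.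
Proof.
rewrite (sum_exchange2 s_inv s_dom zE z_s D_s).
have e a : \sum_(o in slice) D a o ^+ 2 = (w a.1 - w a.2) ^+ 2 * F a.1 a.2.
  by rewrite mulr_sumr; apply: eq_bigr => o _; rewrite exprMn.
under eq_bigr do rewrite e.
(* With a single index, [w0] forces [w = 0] and both sides vanish. *)
case: (pickP (fun p : I * I => p.1 != p.2)) => [[i0 j0] /= ne|eqI]; last first.
  have w_eq i : w i = 0.
    have : \sum_j w j = w i * n.
      rewrite mulr_natr -sumr_const; apply: eq_bigr => j _.
      by have /negbFE/eqP /= -> := eqI (i, j).
    rewrite w0 => /esym/eqP; rewrite mulf_eq0 => /orP[/eqP //|].
    by rewrite gt_eqF.
  rewrite /q [\sum_i _]big1 => [|i _]; last by rewrite w_eq expr0n.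
  rewrite mulr0 mul0r big1 ?mulr0 // => p _.
  by rewrite !w_eq subrr expr0n mul0r.
pose tau := F i0 j0.
have Ft i j : F i j = tau * (i != j)%:R.
  case: (eqVneq i j) => [->|ij]; last by rewrite mulr1; apply: F_const.
  by rewrite mulr0 /F big1 // => X _; rewrite subrr expr0n.
have -> : \sum_(a : I * I) (w a.1 - w a.2) ^+ 2 * F a.1 a.2 = 2 * n * q * tau.
  have -> : 2 * n * q * tau = (\sum_(a : I * I) (w a.1 - w a.2) ^+ 2) * tau.
    under eq_bigr do rewrite expr2.
    rewrite (sum_diff w w) w0 mulr0 subr0 /q; under [in RHS]eq_bigr do rewrite -expr2.
    by [].
  rewrite mulr_suml; apply: eq_bigr => p _; rewrite Ft.
  by case: (eqVneq p.1 p.2) => [->|_]; rewrite ?subrr ?expr0n ?mul0r ?mulr1.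
have tot : \sum_(p : I * I) F p.1 p.2 = 8 * k%:R * (n - k%:R) * #|slice|%:R.
  rewrite exchange_big /= mulr_natr -sumr_const; apply: eq_bigr => X.
  rewrite inE => /eqP Xk.
  under eq_bigr do rewrite expr2.
  rewrite (sum_diff (fun i => sg X i) (fun i => sg X i)) sum_sg Xk.
  under eq_bigr do rewrite -expr2 sgnb_sqr.
  by rewrite sumr_const -/n; ring.
have tau0 : 0 <= tau by apply: sumr_ge0 => X _; exact: sqr_ge0.
have le_tau : 8 * k%:R * (n - k%:R) * #|slice|%:R <= n ^+ 2 * tau.
  rewrite -tot; apply: (@le_trans _ _ (\sum_(p : I * I) tau)).
    by apply: ler_sum => p _; rewrite Ft ler_piMr // lern1 leq_b1.
  by rewrite sumr_const card_prod -[tau *+ _]mulr_natl natrM -/n expr2.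
have q0 : 0 <= q by apply: sumr_ge0 => i _; exact: sqr_ge0.
have -> : n ^+ 2 * ((2 * n)^-1 / 2 * (2 * n * q * tau)) = n ^+ 2 * tau * (q / 2).
  by field; rewrite gt_eqF.
have -> : 4 * k%:R * (n - k%:R) * q * #|slice|%:R =
  8 * k%:R * (n - k%:R) * #|slice|%:R * (q / 2) by field.
by apply: ler_wpM2r => //; rewrite divr_ge0.
Qed.
End Slice.
End SignSums.

(** * The gain for correlated pairs of sign vectors *)

Section Resample.
Variables (R : realFieldType) (I : finType).
Local Notation sg X i := (sgnb R (i \in X)).

Definition resample_class (J X : {set I}) : {set {set I}} :=
  [set Y : {set I} | (#|Y| == #|X|) && (Y :&: J == X :&: J)].

Definition stay_prob (A : {set {set I}}) (J X : {set I}) : R :=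
  #|A :&: resample_class J X|%:R / #|resample_class J X|%:R.

Section SliceGain.
Variables (k : nat) (w : I -> R) (A : {set {set I}}) (c sigma : R).
Let z (X : {set I}) := \sum_i sg X i * w i.
Let q := \sum_i w i ^+ 2.
Let S : {set {set I}} := slice I k.
Let N : R := (2 ^ #|I|)%:R.
Hypothesis w0 : \sum_i w i = 0.
Hypothesis I0 : (0 < #|I|)%N.
Hypothesis q0 : 0 < q.
Hypothesis sigma01 : 0 < sigma <= 1.
Hypothesis S0 : (0 < #|S|)%N.
Hypothesis z2 : sigma * q * #|S|%:R <= \sum_(X in S) z X ^+ 2.
Hypothesis AS : A \subset S.
Hypothesis zA : forall X, X \in A -> z X = c.

Let zJ (p : {set I} * {set I}) := \sum_(i in p.1) sg p.2 i * w i.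
Let rJ (J X : {set I}) := \sum_i sg J i * (sg X i * w i).

(** The indicator of [J] is (1 + sign) / 2, so for fixed [X] and random [J] the retained sum is an
    affine function of a Rademacher sum. *)
Let zJE J X : zJ (J, X) = (z X + rJ J X) / 2.
Proof.
rewrite /zJ /z /rJ -big_split mulr_suml /= big_mkcond /=; apply: eq_bigr => i _.
by case: (i \in J); rewrite /sgnb /=; field.
Qed.

Let uq (X : {set I}) : \sum_i (sg X i * w i) ^+ 2 = q.
Proof. by apply: eq_bigr => i _; rewrite exprMn sgnb_sqr mul1r. Qed.

Let sumc (x : R) : \sum_(J : {set I}) x = N * x.
Proof.
rewrite sumr_const -mulr_natl /N; congr (_%:R * _).
by rewrite -card_set_setT cardsT.
Qed.

Let m1 X : \sum_J zJ (J, X) = N * (z X / 2).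
Proof.
under eq_bigr do rewrite zJE.
by rewrite -mulr_suml big_split /= rademacher1 sumc addr0 mulrA.
Qed.

Let m2 X : \sum_J zJ (J, X) ^+ 2 = N * ((z X ^+ 2 + q) / 4).
Proof.
have -> : \sum_J zJ (J, X) ^+ 2
   = \sum_J (z X ^+ 2 / 4 + z X / 2 * rJ J X + 4^-1 * rJ J X ^+ 2).
  by apply: eq_bigr => J _; rewrite zJE; field.
rewrite !big_split /= -!mulr_sumr rademacher1 rademacher2 uq sumc -/N.
by field.
Qed.

Let m4 X : \sum_J zJ (J, X) ^+ 4 <= N * ((z X ^+ 4 + 3 * q ^+ 2) / 2).
Proof.
apply: (@le_trans _ _ (\sum_J (z X ^+ 4 / 2 + 2^-1 * rJ J X ^+ 4))).
  apply: ler_sum => J _; rewrite zJE -subr_ge0; set a := z X; set b := rJ J X.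
  have -> : a ^+ 4 / 2 + 2^-1 * b ^+ 4 - ((a + b) / 2) ^+ 4 =
     (((a - b) ^+ 2) ^+ 2 + 6 * (a - b) ^+ 2 * (a + b) ^+ 2) / 16 by field.
  have := sqr_ge0 (a - b); have := sqr_ge0 (a + b); set x := (a - b) ^+ 2; set y := (a + b) ^+ 2; nra.
rewrite big_split /= sumc -mulr_sumr.
have := rademacher4 (fun i => sg X i * w i); rewrite uq -/N => h.
have {h} : \sum_(J : {set I}) rJ J X ^+ 4 <= 3 * N * q ^+ 2 by exact: h.
lra.
Qed.

Let Om : {set {set I} * {set I}} := setX [set: {set I}] S.
Let Al : {set {set I} * {set I}} := setX [set: {set I}] A.
Let key (p : {set I} * {set I}) := (p.1, p.2 :&: p.1).

Let sum_Om (B : {set {set I}}) (f : {set I} * {set I} -> R) :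
  \sum_(p in setX [set: {set I}] B) f p = \sum_(X in B) \sum_J f (J, X).
Proof.
transitivity (\sum_(p in setX [set: {set I}] B) f (p.1, p.2)).
  by apply: eq_bigr => -[].
rewrite (sum_setX _ _ (fun J X => f (J, X))) exchange_big /=.
by apply: eq_bigr => X _; apply: eq_bigl => J; rewrite inE.
Qed.

Let card_setT (B : {set {set I}}) : #|setX [set: {set I}] B|%:R = N * #|B|%:R.
Proof. by rewrite cardsX card_set_setT natrM. Qed.

(** This key fixes [J] and the trace of [X] on [J], so a key class is a copy of a resampling
    class. *)
Let stayE J X : X \in A -> condprob R key Om Al (J, X) = stay_prob A J X.
Proof.
move=> XA; have /[!inE] /eqP Xk := subsetP AS X XA.
have kc : keyclass key Om (J, X) = setX [set J] (resample_class J X).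
  apply/setP => -[J' Y]; rewrite !inE /= Xk /key /= -pair_eqE /=.
  by case: (J' =P J) => [->|]; rewrite ?andbF.
rewrite /condprob /stay_prob kc.
have -> : Al :&: setX [set J] (resample_class J X) = setX [set J] (A :&: resample_class J X).
  by apply/setP => -[J' Y]; rewrite !inE /= andbCA.
by rewrite !cardsX cards1 !mul1n.
Qed.

Let keyz p p' : key p = key p' -> zJ p = zJ p'.
Proof.
case: p p' => [J X] [J' X'] [<- e]; apply: eq_bigr => i iJ /=.
by move/setP/(_ i): e; rewrite !inE iJ !andbT => ->.
Qed.

(** Any centered function of the retained data can serve as chi-square test function; it remains to
    find one whose mean on [A] is comparable to its standard deviation. *)
Let main (f : {set I} * {set I} -> R) (De V : R) :
  (forall o o', key o = key o' -> f o = f o') -> 0 < V ->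
  \sum_(X in S) \sum_J f (J, X) = 0 ->
  (forall X, X \in A -> \sum_J f (J, X) = N * De) ->
  \sum_(X in S) \sum_J f (J, X) ^+ 2 <= N * #|S|%:R * V ->
  sigma ^+ 2 / 480 <= De ^+ 2 / V ->
  N * (#|A|%:R ^+ 2 / #|S|%:R) * (1 + sigma ^+ 2 / 480)
  <= \sum_(X in A) \sum_J stay_prob A J X.
Proof.
move=> fk V0 f0 fA f2 le_s.
have N0 : 0 < N by rewrite ltr0n expn_gt0.
have SS : 0 < #|S|%:R :> R by rewrite ltr0n.
have AlOm : Al \subset Om.
  by apply/subsetP => -[J X]; rewrite !inE /= => /(subsetP AS); rewrite inE.
have Om0 : (0 < #|Om|)%N by rewrite cardsX card_set_setT muln_gt0 expn_gt0.
have := @sum_condprob_ge R _ _ key Om Al AlOm f De V fk Om0 V0.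
rewrite !sum_Om !card_setT => /(_ f0).
have -> : \sum_(X in A) \sum_J f (J, X) = N * #|A|%:R * De.
  rewrite (eq_bigr (fun=> N * De)) // sumr_const -mulr_natr; ring.
move=> /(_ erefl f2).
have -> : \sum_(X in A) \sum_J condprob R key Om Al (J, X) = \sum_(X in A) \sum_J stay_prob A J X.
  by apply: eq_bigr => X XA; apply: eq_bigr => J _; rewrite stayE.
apply: le_trans.
have -> : (N * #|A|%:R) ^+ 2 / (N * #|S|%:R) = N * (#|A|%:R ^+ 2 / #|S|%:R).
  by field; rewrite !gt_eqF.
apply: ler_wpM2l; last by rewrite lerD2l.
by rewrite mulr_ge0 ?divr_ge0 ?sqr_ge0 ?ltW.
Qed.

Lemma slice_gain :
  N * (#|A|%:R ^+ 2 / #|S|%:R) * (1 + sigma ^+ 2 / 480)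
  <= \sum_(X in A) \sum_J stay_prob A J X.
Proof.
have N0 : 0 < N by rewrite ltr0n expn_gt0.
have SS : 0 < #|S|%:R :> R by rewrite ltr0n.
case/andP: sigma01 => s0 s1.
have q0' := q0.
have sumS (x : R) : \sum_(X in S) x = x * #|S|%:R by rewrite sumr_const mulr_natr.
 have M2 := slice2_le k w0 I0; have M4 := slice4_le k w0 I0.
pose Ez2 := (\sum_(X in S) z X ^+ 2) / #|S|%:R.
have Ez2E : \sum_(X in S) z X ^+ 2 = Ez2 * #|S|%:R by rewrite divfK // gt_eqF.
have Ez2_le : Ez2 <= 2 * q by rewrite ler_pdivrMr.
have Ez2_ge : sigma * q <= Ez2 by rewrite ler_pdivlMr.
(* On A the retained sum zJ has mean c / 2 and variance q / 4, while on the whole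
   slice it has mean 0 and variance (Ez2 + q) / 4: either the means or the second
   moments differ by a constant factor. *)
have [cbig|csmall] := lerP (sigma * q / 2) (c ^+ 2).
(* Here (Ez2 + q) / 4 <= 3/4 q, and De^2 / V = c^2 / (3 q) is at least sigma / 6. *)
- apply: (main (f := zJ) (De := c / 2) (V := 3 / 4 * q)).
  + exact: keyz.
  + by lra.
  + under eq_bigr do rewrite m1.
    by rewrite -mulr_sumr -mulr_suml (slice1 k w0 I0) mul0r mulr0.
  + by move=> X XA; rewrite m1 zA.
  + under eq_bigr do rewrite m2.
    rewrite -mulr_sumr -mulrA ler_pM2l // -mulr_suml big_split /= sumS Ez2E.
    rewrite -mulrDl mulrAC mulrC ler_pM2l //; lra.
  + have -> : (c / 2) ^+ 2 / (3 / 4 * q) = c ^+ 2 / (3 * q) by field; rewrite gt_eqF.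
    rewrite ler_pdivlMr; last by lra.
    have : sigma ^+ 2 <= sigma by rewrite expr2 ler_piMr // ltW.
    nra.
- pose V := (Ez2 + q) / 4.
  (* The fourth moments bound the variance by (12 + 3) / 2 q^2, while De <= - sigma q / 8; hence the
     constant 480 = 64 * 15 / 2. *)
  apply: (main (f := fun p => zJ p ^+ 2 - V) (De := (c ^+ 2 - Ez2) / 4) (V := 15 / 2 * q ^+ 2)).
  + by move=> p p' /keyz ->.
  + have := exprn_gt0 2 q0; lra.
  + under eq_bigr do rewrite sumrB m2 sumc.
    rewrite sumrB -mulr_sumr -mulr_suml big_split /= !sumS Ez2E /V; ring.
  + by move=> X XA; rewrite sumrB m2 sumc zA // /V; field.
  + have V0 : 0 <= V by rewrite divr_ge0 // addr_ge0 // ?(le_trans _ Ez2_ge) // ?mulr_ge0 // ltW.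
    have e X : \sum_J (zJ (J, X) ^+ 2 - V) ^+ 2 <=
      N * ((z X ^+ 4 + 3 * q ^+ 2) / 2) - 2 * V * (N * ((z X ^+ 2 + q) / 4)) + N * V ^+ 2.
      have -> : \sum_J (zJ (J, X) ^+ 2 - V) ^+ 2 =
        \sum_J zJ (J, X) ^+ 4 - 2 * V * (\sum_J zJ (J, X) ^+ 2) + \sum_(J : {set I}) V ^+ 2.
        rewrite mulr_sumr -sumrN -!big_split /=; apply: eq_bigr => J _; ring.
      by rewrite m2 sumc !lerD2r; exact: m4.
    apply: le_trans (ler_sum _ (fun X _ => e X)) _.
    rewrite big_split sumrB /= -!mulr_sumr -!mulr_suml !big_split /= -mulr_suml.
    rewrite !sumS Ez2E.
    have := M4; rewrite -/z -/q -/S; set F4 := \sum_(X in S) _ => M4'.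
    rewrite -/V.
    rewrite [X in X <= _](_ : _ = N * ((F4 + 3 * q ^+ 2 * #|S|%:R) / 2 - V ^+ 2 * #|S|%:R));
      last by rewrite /V; field.
    rewrite -[X in _ <= X]mulrA ler_pM2l //.
    have : 0 <= V ^+ 2 * #|S|%:R by rewrite mulr_ge0 ?sqr_ge0.
    lra.
  + rewrite ler_pdivlMr; last by have := exprn_gt0 2 q0; lra.
    have -> : sigma ^+ 2 / 480 * (15 / 2 * q ^+ 2) = (sigma * q / 8) ^+ 2 by field.
    have sq0 : 0 < sigma * q by rewrite mulr_gt0.
    rewrite -[X in _ <= X]sqrrN ler_pXn2r // ?nnegrE; lra.
Qed.
End SliceGain.
End Resample.

Lemma sum_setU (V : nmodType) (T : finType) (A B : {set T}) (f : T -> V) :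
  [disjoint A & B] ->
  \sum_(x in A :|: B) f x = \sum_(x in A) f x + \sum_(x in B) f x.
Proof.
by move=> AB; rewrite -bigU //=; apply: eq_bigl => x; rewrite inE.
Qed.

(** * The correlated pair on two adjacent layers *)

Section Layers.
Variables (R : realType) (I : finType) (a : nat) (eps1 : R).
Local Notation n := #|I|.
Local Notation sg X i := (sgnb R[i] (i \in X)).

(* A sign vector is represented by its set of +1 coordinates; coordinate sum
   s - 1 or s + 1 means cardinality a or a + 1, where 2 a = n + s - 1. *)
Definition layers : {set {set I}} := slice I a :|: slice I a.+1.

Lemma layers_disjoint : [disjoint slice I a & slice I a.+1].
Proof.
rewrite -setI_eq0; apply/eqP/setP => X; rewrite !inE.
by apply/negP => /andP[/eqP ->]; rewrite eqn_leq ltnn andbF.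
Qed.

Lemma card_slice k : #|slice I k| = 'C(n, k).
Proof.
rewrite -cardsT -cards_draws; apply: eq_card => X.
by rewrite !inE subsetT.
Qed.

Lemma card_layers : #|layers| = ('C(n, a) + 'C(n, a.+1))%N.
Proof.
have /leqifP := leq_card_setU (slice I a) (slice I a.+1).
by rewrite layers_disjoint !card_slice => /eqP.
Qed.

(* Joint law of a pair: X uniform on the layers, J a uniform set of retained
   coordinates, Y uniform among the sets of the layer of X agreeing with X on J. *)
Definition resample_wt (X Y : {set I}) : R :=
  (#|layers|%:R * (2 ^ n)%:R)^-1 * \sum_(J : {set I}) (Y \in resample_class J X)%:R / #|resample_class J X|%:R.

Lemma wt_ge0 X Y : 0 <= resample_wt X Y.
Proof.
rewrite mulr_ge0 ?invr_ge0 ?mulr_ge0 //.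
by apply: sumr_ge0 => J _; rewrite divr_ge0.
Qed.

Lemma cls_refl (J X : {set I}) : X \in resample_class J X.
Proof. by rewrite inE !eqxx. Qed.

Lemma card_cls_gt0 (J X : {set I}) : (0 < #|resample_class J X|)%N.
Proof. by apply/card_gt0P; exists X; apply: cls_refl. Qed.

Lemma sum_wt (A : {set {set I}}) X : \sum_(Y in A) resample_wt X Y =
  (#|layers|%:R * (2 ^ n)%:R)^-1 * \sum_J stay_prob R A J X.
Proof.
rewrite /resample_wt -mulr_sumr exchange_big /=; congr (_ * _); apply: eq_bigr => J _.
rewrite -mulr_suml; congr (_ / _).
rewrite -sum1_card natr_sum big_mkcond [RHS]big_mkcond /=.
by apply: eq_bigr => Y _; rewrite in_setI; case: (Y \in A); case: (Y \in resample_class J X).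
Qed.

Lemma sum_wt_row_le (A : {set {set I}}) X : \sum_(Y in A) resample_wt X Y <= (#|layers|%:R)^-1.
Proof.
rewrite sum_wt invfM -mulrA ler_piMr ?invr_ge0 //.
rewrite mulrC ler_pdivrMr ?ltr0n ?expn_gt0 // mul1r -card_set_setT -sum1_card natr_sum.
rewrite [X in _ <= X](eq_bigl predT) /=; last by move=> J; rewrite inE.
apply: ler_sum => J _; rewrite ler_pdivrMr ?ltr0n ?card_cls_gt0 // mul1r ler_nat.
exact/subset_leq_card/subsetIr.
Qed.

Lemma sum_wt_le1 : \sum_(X in layers) \sum_(Y in layers) resample_wt X Y <= 1.
Proof.
apply: le_trans (ler_sum _ (fun X _ => sum_wt_row_le layers X)) _.
rewrite sumr_const -[_ *+ _]mulr_natl.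
case: (eqVneq (#|layers|%:R : R) 0) => [->|h]; first by rewrite mul0r.
by rewrite divff.
Qed.

Section Slices.
Variables (v : I -> R[i]) (c : R[i]).
Let z (X : {set I}) := \sum_i sg X i * v i.

(** Passes from complex [v] to the real bound through an additive [phi], in use the real or
    imaginary part. Centering at the mean m shifts the sum by m (2 k - n), which is constant on the
    slice, so [A] still lies in one level set. *)
Lemma slice_gain_functional (phi : R[i] -> R) (k : nat) (A : {set {set I}}) (sigma : R) :
  phi 0 = 0 -> {morph phi : x y / x + y} -> {morph phi : x / - x} ->
  (exists i j, phi (v i) != phi (v j)) ->
  A \subset slice I k -> (forall X, X \in A -> z X = c) ->
  0 < sigma <= 1 -> sigma * n%:R ^+ 2 <= 4 * k%:R * (n%:R - k%:R) -> (k <= n)%N ->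
  (2 ^ n)%:R * (#|A|%:R ^+ 2 / #|slice I k|%:R) * (1 + sigma ^+ 2 / 480)
  <= \sum_(X in A) \sum_J stay_prob R A J X.
Proof.
move=> phi0 phiD phiN [i0 [j0 vij]] AS zA s01 sk kn.
have n0 : (0 < n)%N by apply/card_gt0P; exists i0.
have nn : n%:R != 0 :> R by rewrite pnatr_eq0 -lt0n.
pose m := (\sum_i phi (v i)) / n%:R.
pose w i := phi (v i) - m.
have w0 : \sum_i w i = 0.
  by rewrite sumrB sumr_const -[m *+ _]mulr_natr divfK // subrr.
have q0 : 0 < \sum_i w i ^+ 2.
  have q_ge0 : 0 <= \sum_i w i ^+ 2 by apply: sumr_ge0 => i _; exact: sqr_ge0.
  rewrite lt_neqAle q_ge0 andbT eq_sym; apply: contra vij.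
  rewrite psumr_eq0 => [/allP h|i _]; last exact: sqr_ge0.
  have w_eq0 i : phi (v i) = m.
    by have := h i (mem_index_enum i); rewrite /= sqrf_eq0 subr_eq0 => /eqP.
  by rewrite !w_eq0.
have S0 : (0 < #|slice I k|)%N by rewrite card_slice bin_gt0.
apply: (slice_gain (w := w) (c := phi c - m * (2 * k%:R - n%:R))) => //.
  have := slice2_ge k w0 n0; set q := \sum_i _ => h.
  have n2 : 0 < n%:R ^+ 2 :> R by rewrite exprn_gt0 ?ltr0n.
  rewrite -(ler_pM2l n2); apply: le_trans h.
  rewrite mulrCA mulrA [_ * n%:R ^+ 2]mulrC mulrA.
  by apply: ler_wpM2r => //; apply: ler_wpM2r; [exact: ltW | rewrite mulrC].
move=> X XA; rewrite -(zA X XA) /z (big_morph phi phiD phi0).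
have /[!inE] /eqP Xk := subsetP AS X XA.
transitivity (\sum_i (sgnb R (i \in X) * phi (v i) - sgnb R (i \in X) * m)).
  by apply: eq_bigr => i _; rewrite -mulrBr.
rewrite sumrB -mulr_suml sum_sg Xk [_ * m]mulrC; congr (_ - _).
apply: eq_bigr => i _; case: (i \in X); rewrite /sgnb ?mul1r //.
by rewrite !mulN1r phiN.
Qed.
End Slices.

Hypothesis eps_gt0 : 0 < eps1.
Hypothesis eps_le : eps1 * n%:R <= a%:R.
Hypothesis eps_le' : eps1 * n%:R <= n%:R - a%:R - 1.

(** The value sigma^2 / 480 for sigma = 4 eps1^2, a lower bound for 4 k (n - k) / n^2 on both
    layers. *)
Definition gain : R := eps1 ^+ 4 / 30.

Let an : (a.+1 <= n)%N.
Proof.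
have : 0 <= eps1 * n%:R by rewrite mulr_ge0 // ltW.
by rewrite -(ler_nat R) -natr1; move: eps_le'; lra.
Qed.

Let n0 : (0 < n)%N. Proof. exact: leq_trans an. Qed.
Let nn0 : 0 < n%:R :> R. Proof. by rewrite ltr0n. Qed.

Lemma eps1_le : eps1 <= 2^-1.
Proof.
rewrite -(ler_pM2r nn0); move: eps_le eps_le'; lra.
Qed.

Lemma gain_gt0 : 0 < gain.
Proof. by rewrite divr_gt0 // exprn_gt0. Qed.

Lemma card_layers_gt0 : (0 < #|layers|)%N.
Proof. by rewrite card_layers addn_gt0 !bin_gt0 an orbT. Qed.

(** The two adjacent binomial coefficients are within a factor [eps1] of each other, and
    [gain eps1 <= eps1]. This replaces the chi-square gain when [v] is constant and its level sets
    are whole layers. *)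
Lemma slice_le_layers k : k \in [:: a; a.+1] ->
  #|slice I k|%:R * (1 + gain) <= #|layers|%:R :> R.
Proof.
have e1 := eps1_le; have e0 := eps_gt0.
have gain_le : gain <= eps1.
  have -> : gain = eps1 * (eps1 ^+ 3 / 30) by rewrite /gain; field.
  rewrite ler_piMr ?(ltW e0) // ler_pdivrMr // mul1r.
  by apply: (@le_trans _ _ 1) => //; rewrite ?exprn_ile1 ?ltW //; lra.
have binE : ('C(n, a.+1)%:R : R) * a.+1%:R = 'C(n, a)%:R * (n%:R - a%:R).
  have e : (a.+1 * 'C(n, a.+1))%N = ((n - a) * 'C(n, a))%N by rewrite mul_bin_left.
  by rewrite -natrB ?(ltnW an) // -!natrM mulnC e mulnC.
have S1 : 0 <= 'C(n, a)%:R :> R by rewrite ?ler0n ?ltr0Sn.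
have S2 : 0 <= 'C(n, a.+1)%:R :> R by rewrite ?ler0n ?ltr0Sn.
have a1 : 0 < a.+1%:R :> R by rewrite ?ler0n ?ltr0Sn.
have a1E : a.+1%:R = a%:R + 1 :> R by rewrite -natr1.
have ann : a.+1%:R <= n%:R :> R by rewrite ler_nat.
have le12 : eps1 * 'C(n, a)%:R <= 'C(n, a.+1)%:R.
  rewrite -(ler_pM2r a1) binE mulrAC mulrC; apply: ler_wpM2l => //.
  have : eps1 * a.+1%:R <= eps1 * n%:R by rewrite ler_wpM2l // ltW.
  move: eps_le'; lra.
have le21 : eps1 * 'C(n, a.+1)%:R <= 'C(n, a)%:R.
  have na : 0 < n%:R - a%:R :> R by lra.
  rewrite -(ler_pM2r na) -binE mulrAC mulrC; apply: ler_wpM2l => //.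
  have : eps1 * (n%:R - a%:R) <= eps1 * n%:R.
    by apply: ler_wpM2l; [exact: ltW | rewrite gerBl ler0n].
  move: eps_le; lra.
rewrite card_layers natrD !inE => /orP[]/eqP ->; rewrite card_slice.
  have : gain * 'C(n, a)%:R <= eps1 * 'C(n, a)%:R by rewrite ler_wpM2r.
  lra.
have : gain * 'C(n, a.+1)%:R <= eps1 * 'C(n, a.+1)%:R by rewrite ler_wpM2r.
lra.
Qed.

Section Gain.
Variables (v : I -> R[i]) (c : R[i]).
Hypothesis v_neq0 : exists i, v i != 0.
Let z (X : {set I}) := \sum_i sg X i * v i.
Let A := [set X in layers | z X == c].
Let Ak k := A :&: slice I k.

Let stayE k X J : X \in slice I k -> stay_prob R A J X = stay_prob R (Ak k) J X.
Proof.
rewrite inE => /eqP Xk; congr (_%:R / _).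
apply: eq_card => Y; rewrite !inE Xk.
by case: (#|Y| =P k) => _; rewrite ?andbT ?andbF.
Qed.

Let sum_A (f : {set I} -> R) :
  \sum_(X in A) f X = \sum_(X in Ak a) f X + \sum_(X in Ak a.+1) f X.
Proof.
have -> : A = Ak a :|: Ak a.+1.
  by apply/setP => X; rewrite !inE; case: (z X == c); case: (#|X| == a); case: (#|X| == a.+1).
apply: sum_setU.
exact: disjointWl (subsetIr _ _) (disjointWr (subsetIr _ _) layers_disjoint).
Qed.

Let card_A : #|A|%:R = #|Ak a|%:R + #|Ak a.+1|%:R :> R.
Proof. by have := sum_A (fun=> 1); rewrite !sumr_const. Qed.

Let stay_A : \sum_(X in A) \sum_J stay_prob R A J X =
  \sum_(X in Ak a) \sum_J stay_prob R (Ak a) J X +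
  \sum_(X in Ak a.+1) \sum_J stay_prob R (Ak a.+1) J X.
Proof.
rewrite sum_A; congr (_ + _); apply: eq_bigr => X; rewrite inE => /andP[_ Xk];
by apply: eq_bigr => J _; apply: stayE.
Qed.

Let S_E : #|layers|%:R = #|slice I a|%:R + #|slice I a.+1|%:R :> R.
Proof. by rewrite card_layers !card_slice natrD. Qed.

Let N0 : 0 < (2 ^ n)%:R :> R. Proof. by rewrite ltr0n expn_gt0. Qed.

Let slice0 k : k \in [:: a; a.+1] -> 0 < #|slice I k|%:R :> R.
Proof.
rewrite !inE ltr0n card_slice bin_gt0 => /orP[]/eqP ->; last exact: an.
exact: ltnW an.
Qed.

Let nonconst i0 j0 : v i0 != v j0 -> forall k, k \in [:: a; a.+1] ->
  (2 ^ n)%:R * (#|Ak k|%:R ^+ 2 / #|slice I k|%:R) * (1 + gain)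
  <= \sum_(X in Ak k) \sum_J stay_prob R (Ak k) J X.
Proof.
move=> vij k kin.
have e1 := eps1_le; have e0 := eps_gt0.
have gE : gain = (4 * eps1 ^+ 2) ^+ 2 / 480 by rewrite /gain; field.
have s01 : 0 < 4 * eps1 ^+ 2 <= 1.
  rewrite mulr_gt0 ?exprn_gt0 //=.
  have : eps1 * eps1 <= 2^-1 * 2^-1 by apply: ler_pM => //; apply: ltW.
  rewrite expr2; lra.
have kb : eps1 * n%:R <= k%:R /\ eps1 * n%:R <= n%:R - k%:R.
  move: kin eps_le eps_le'; rewrite !inE => /orP[]/eqP -> h1 h2; split; rewrite -?natr1; lra.
have sk : 4 * eps1 ^+ 2 * n%:R ^+ 2 <= 4 * k%:R * (n%:R - k%:R).
  have -> : 4 * eps1 ^+ 2 * n%:R ^+ 2 = 4 * ((eps1 * n%:R) * (eps1 * n%:R)) by ring.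
  rewrite -[X in _ <= X]mulrA; apply: ler_wpM2l; first by rewrite ler0n.
  by case: kb => h1 h2; apply: ler_pM => //; rewrite mulr_ge0 // ltW.
have kn : (k <= n)%N.
  by move: kin; rewrite !inE => /orP[]/eqP -> //; apply: ltnW an.
have zA X : X \in Ak k -> z X = c by rewrite !inE => /andP[/andP[_ /eqP]].
have Sub : Ak k \subset slice I k by apply: subsetIr.
rewrite gE.
have [/eqP Reij|Reij] := boolP (complex.Re (v i0) == complex.Re (v j0)).
  apply: (@slice_gain_functional v c (@complex.Im R)) => //; [by case=> ? ? [] | by case | ].
  exists i0, j0; apply: contra vij => /eqP; rewrite eq_complex Reij eqxx => ->.
  exact: eqxx.
apply: (@slice_gain_functional v c (@complex.Re R)) => //; [by case=> ? ? [] | by case | ].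
by exists i0, j0.
Qed.

Lemma layers_gain :
  (1 + gain) * (#|A|%:R / #|layers|%:R) ^+ 2 <= \sum_(X in A) \sum_(Y in A) resample_wt X Y.
Proof.
have S0 : 0 < #|layers|%:R :> R by rewrite ltr0n card_layers_gt0.
have SN : 0 < #|layers|%:R * (2 ^ n)%:R :> R by rewrite mulr_gt0.
under eq_bigr do rewrite sum_wt.
rewrite -mulr_sumr ler_pdivlMl // stay_A.
have Sa := slice0 (mem_head a [:: a.+1]).
have Sa1 : 0 < #|slice I a.+1|%:R :> R by apply: slice0; rewrite !inE eqxx orbT.
have g0 := gain_gt0.
have [/forallP h|] := boolP [forall i, forall j, v i == v j]; last first.
  move/forallPn => [i0 /forallPn [j0 vij]].
  have h1 := nonconst vij (mem_head a [:: a.+1]).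
  have h2 : (2 ^ n)%:R * (#|Ak a.+1|%:R ^+ 2 / #|slice I a.+1|%:R) * (1 + gain)
    <= \sum_(X in Ak a.+1) \sum_J stay_prob R (Ak a.+1) J X.
    by apply: (nonconst vij); rewrite !inE eqxx orbT.
  apply: le_trans (lerD h1 h2); rewrite card_A S_E.
  set x := #|Ak a|%:R; set y := #|Ak a.+1|%:R; set s := #|slice I a|%:R; set t := #|slice I a.+1|%:R.
  have st : 0 < s + t by rewrite addr_gt0.
  (* The two layers combine by Cauchy-Schwarz, x^2 / s + y^2 / t >= (x + y)^2 / (s + t), with the
     difference written as an explicit square. *)
  rewrite -subr_ge0.
  have -> : (2 ^ n)%:R * (x ^+ 2 / s) * (1 + gain) + (2 ^ n)%:R * (y ^+ 2 / t) * (1 + gain)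
     - (s + t) * (2 ^ n)%:R * ((1 + gain) * ((x + y) / (s + t)) ^+ 2)
    = (2 ^ n)%:R * (1 + gain) * ((x * t - y * s) ^+ 2 / (s * t * (s + t))).
    by field; rewrite !gt_eqF.
  apply: mulr_ge0; first by apply: mulr_ge0; [exact: ltW | lra].
  apply: divr_ge0; first exact: sqr_ge0.
  by apply/ltW/mulr_gt0 => //; apply: mulr_gt0.
(* Constant nonzero [v]: the sum depends only on the size of the set, so [A] is empty or one full
   layer. Resampling never leaves it, and the gain comes from [slice_le_layers]. *)
case: v_neq0 => i0 vi0.
have vE i : v i = v i0 by have /forallP/(_ i0)/eqP := h i.
have zE X : z X = v i0 * (2 * #|X|%:R - n%:R).
  rewrite /z; under eq_bigr do rewrite vE.
  rewrite -mulr_suml mulrC; congr (_ * _).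
  transitivity (\sum_i (2 * (i \in X)%:R - 1 : R[i])).
    by apply: eq_bigr => i _; case: (i \in X); rewrite /sgnb /= ?mulr1 ?mulr0 ?sub0r //; ring.
  rewrite sumrB -mulr_sumr sumr_const -natr_sum; congr (_ * _%:R - _).
  by rewrite -sum1_card [in RHS]big_mkcond /=; apply: eq_bigr => i _; case: (i \in X).
have A_const (X Y : {set I}) : X \in A -> #|Y| = #|X| -> Y \in layers -> Y \in A.
  by rewrite !inE => /andP[_ /eqP <-] e ->; rewrite !zE e eqxx.
have Ak_full k : k \in [:: a; a.+1] -> Ak k = set0 \/ Ak k = slice I k.
  move=> kin; case: (set_0Vmem (Ak k)) => [->|[X XA]]; [by left|right].
  apply/eqP; rewrite eqEsubset subsetIr /=; apply/subsetP => Y Yk.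
  move: XA; rewrite inE => /andP[XA]; rewrite inE => /eqP Xk.
  rewrite inE Yk andbT; apply: (A_const X) => //.
    by rewrite Xk; move: Yk; rewrite inE => /eqP.
  by move: Yk kin; rewrite !inE => /eqP ->.
have Ak_sum k : k \in [:: a; a.+1] ->
  \sum_(X in Ak k) \sum_J stay_prob R (Ak k) J X = (2 ^ n)%:R * #|Ak k|%:R.
  move=> kin; case: (Ak_full k kin) => ->; first by rewrite big_set0 cards0 mulr0.
  rewrite mulr_natr -sumr_const; apply: eq_bigr => X Xk.
  transitivity (\sum_(J : {set I}) (1 : R)).
    apply: eq_bigr => J _; rewrite /stay_prob.
    have -> : slice I k :&: resample_class J X = resample_class J X.
      apply/setIidPr/subsetP => Y; move: Xk; rewrite !inE => /eqP -> /andP[]//.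
    by rewrite divff // pnatr_eq0 -lt0n card_cls_gt0.
  by rewrite sumr_const -card_set_setT cardsT.
have one : Ak a = set0 \/ Ak a.+1 = set0.
  case: (set_0Vmem (Ak a)) => [->|[X]]; [by left|rewrite !inE => /andP[/andP[_ zX] /eqP Xa]].
  case: (set_0Vmem (Ak a.+1)) => [->|[Y]]; [by right|rewrite !inE => /andP[/andP[_ zY] /eqP Ya]].
  have two0 : 2 != 0 :> R[i] by rewrite pnatr_eq0.
  exfalso; move: zX; rewrite -(eqP zY) !zE Xa Ya => /eqP/(mulfI vi0)/addIr/(mulfI two0)/eqP.
  by rewrite eqr_nat eqn_leq ltnn ?andbF.
rewrite !Ak_sum ?inE ?eqxx ?orbT // -mulrDr -card_A.
have cA : #|A|%:R * (1 + gain) <= #|layers|%:R :> R.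
  rewrite card_A.
  case: one => [h1|h2].
    rewrite h1 cards0 add0r; apply: le_trans (slice_le_layers (k := a.+1) _).
      by apply: ler_wpM2r; [lra|rewrite ler_nat; apply/subset_leq_card/subsetIr].
    by rewrite !inE eqxx orbT.
  rewrite h2 cards0 addr0; apply: le_trans (slice_le_layers (k := a) _).
    by apply: ler_wpM2r; [lra|rewrite ler_nat; apply/subset_leq_card/subsetIr].
  by rewrite !inE eqxx.
rewrite -subr_ge0.
have -> : (2 ^ n)%:R * #|A|%:R -
   #|layers|%:R * (2 ^ n)%:R * ((1 + gain) * (#|A|%:R / #|layers|%:R) ^+ 2)
  = (2 ^ n)%:R * #|A|%:R / #|layers|%:R * (#|layers|%:R - #|A|%:R * (1 + gain)).
  by field; rewrite gt_eqF.
by apply: mulr_ge0; [apply: divr_ge0; [apply: mulr_ge0|] | rewrite subr_ge0]; rewrite // ler0n.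
Qed.
End Gain.
End Layers.

(** * Odlyzko-type estimates on a layer *)

Section Binomial.
Variable R : realFieldType.

(** Prescribing the trace of a random k-set on L points, j of them inside: reveal the points one by
    one, each prescribed outcome having conditional probability at most 1 - eta. The slack [L] in
    the hypotheses keeps this true through all L steps. *)
Lemma bin_ratio (eta : R) L : eta <= 1 -> forall b k j : nat,
  0 <= eta -> (j <= L)%N ->
  eta * b%:R + L%:R <= k%:R -> eta * b%:R + L%:R <= b%:R - k%:R ->
  'C(b - L, k - j)%:R <= (1 - eta) ^+ L * 'C(b, k)%:R :> R.
Proof.
move=> eta1; elim: L => [|L IH] b k j eta0.
  by rewrite leqn0 => /eqP -> _ _; rewrite !subn0 expr0 mul1r.
rewrite -natr1 => jL hk hbk.
have eb : 0 <= eta * b%:R by rewrite mulr_ge0.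
have L0 : 0 <= L%:R :> R by rewrite ?ler0n ?ltr0Sn.
case: b hk hbk eb => [|b] hk hbk eb.
  by move: hk hbk; rewrite mulr0; lra.
have bE : b.+1%:R = b%:R + 1 :> R by rewrite natr1.
have b0 : 0 < b.+1%:R :> R by rewrite ?ler0n ?ltr0Sn.
have step k' : eta * b.+1%:R <= b.+1%:R - k'%:R -> 'C(b, k')%:R * b.+1%:R = (b.+1%:R - k'%:R) * 'C(b.+1, k')%:R :> R.
  move=> h; have kb : (k' <= b.+1)%N by rewrite -(ler_nat R); move: h; lra.
  rewrite -natrB // -!natrM; congr _%:R.
  by rewrite mulnC; exact: (mul_bin_down b.+1 k').
case: j jL => [|j] jL; last first.
  case: k hk hbk => [|k] hk hbk; first by move: hk eb; lra.
  have kE : k.+1%:R = k%:R + 1 :> R by rewrite natr1.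
  rewrite !subSS; apply: le_trans (IH b k j _ _ _ _) _ => //.
  - by move: hk; rewrite bE kE; nra.
  - by move: hbk; rewrite bE kE; nra.
  rewrite exprSr -mulrA; apply: ler_wpM2l; first by rewrite exprn_ge0 // subr_ge0.
  rewrite -(ler_pM2r b0) mulrC -natrM mul_bin_diag natrM mulrAC.
  apply: ler_wpM2r => //; lra.
rewrite subSS subn0.
have -> : 'C(b - L, k) = 'C(b - L, k - 0) by rewrite subn0.
apply: le_trans (IH b k 0%N _ _ _ _) _ => //.
- by move: hk; rewrite bE; nra.
- by move: hbk; rewrite bE; nra.
rewrite exprSr -mulrA; apply: ler_wpM2l; first by rewrite exprn_ge0 // subr_ge0.
rewrite -(ler_pM2r b0) step; last by lra.
by rewrite mulrAC; apply: ler_wpM2r => //; lra.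
Qed.
End Binomial.

Section Tail.
Variables (R : realFieldType) (I : finType).

(** The sum factorizes over coordinates; a point of [Z] contributes 1 + 1/2, any other point
    contributes 2. *)
Lemma sum_half_pow (Z : {set I}) :
  \sum_(J : {set I}) (2^-1 : R) ^+ #|Z :\: J| = (2 ^ #|I|)%:R * (3 / 4) ^+ #|Z|.
Proof.
pose G i (b : bool) : R := if b then 1 else if i \in Z then 2^-1 else 1.
pose h (f : {ffun I -> bool}) := [set i | f i].
have hK : cancel (fun J : {set I} => [ffun i => i \in J]) h.
  by move=> J; apply/setP => i; rewrite inE ffunE.
have Kh : cancel h (fun J : {set I} => [ffun i => i \in J]).
  by move=> f; apply/ffunP => i; rewrite ffunE inE.
rewrite (reindex h) /=; last by exists (fun J : {set I} => [ffun i => i \in J]) => ? _.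
transitivity (\sum_(f : {ffun I -> bool}) \prod_i G i (f i)).
  apply: eq_bigr => f _; rewrite -prodr_const big_mkcond /=; apply: eq_bigr => i _.
  by rewrite !inE /G; case: (f i); case: (i \in Z).
rewrite -bigA_distr_bigA /=.
transitivity (\prod_i (2 * (if i \in Z then 3 / 4 else 1) : R)).
  by apply: eq_bigr => i _; rewrite big_bool /G /=; case: (i \in Z); field.
rewrite big_split /= prodr_const -natrX; congr (_ * _).
by rewrite -big_mkcond prodr_const.
Qed.

(** Markov's inequality for 2^(-|Z \ J|), using (3/4)^4 <= (2/3) / 2. *)
Lemma setD_tail (Z : {set I}) (l : nat) : (4 * l <= #|Z|)%N ->
  #|[set J : {set I} | (#|Z :\: J| < l)%N]|%:R <= (2 ^ #|I|)%:R * (2 / 3) ^+ l :> R.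
Proof.
move=> lZ.
have h2 : 0 <= 2^-1 :> R by rewrite invr_ge0.
have le1 : #|[set J : {set I} | (#|Z :\: J| < l)%N]|%:R * 2^-1 ^+ l <=
   \sum_(J : {set I}) (2^-1 : R) ^+ #|Z :\: J|.
  rewrite mulr_natl -sumr_const [X in X <= _]big_mkcond /=.
  apply: ler_sum => J _; case: ifP => [|_]; last by rewrite exprn_ge0.
  rewrite inE => /ltnW h; apply: ler_wiXn2l => //; lra.
rewrite -(ler_pM2r (exprn_gt0 l (_ : 0 < 2^-1 :> R))); last by rewrite invr_gt0.
apply: le_trans le1 _; rewrite sum_half_pow -mulrA; apply: ler_wpM2l => //.
apply: (@le_trans _ _ ((3 / 4) ^+ (4 * l))).
  by apply: ler_wiXn2l => //; lra.
rewrite exprM -exprMn; apply: lerXn2r; rewrite ?nnegrE; lra.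
Qed.
End Tail.

(** * Sign vectors in a subspace of affine relations *)

Section Odlyzko.
Variables (R : realType) (K : numFieldType) (n : nat).
Implicit Types (J X Y Z P : {set 'I_n}).

(** Homogeneous coordinates: the final 1 meets the entry -c of [homogenized v c], so the product
    vanishes exactly when x.v = c. *)
Definition relation X : 'rV[K]_(n + 1) := row_mx (\row_j sgnb K (j \in X)) 1%:M.

(** Coordinates in [P] are determined by the others: two vectors of [U] with equal last entry that
    agree off [P] coincide. *)
Definition pivots (U : 'M[K]_(n + 1)) P :=
  forall y : 'rV[K]_n, (forall i, i \notin P -> y 0 i = 0) ->
    (row_mx y 0 <= U)%MS -> y = 0.

Lemma pivots_sub U P P' : P' \subset P -> pivots U P -> pivots U P'.
Proof.
move=> sP pP y y0; apply: pP => i iP; apply: y0.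
by apply: contra iP; apply: (subsetP sP).
Qed.

(** The cokernel matrix of [U] has rank n + 1 - rank U, and dropping its last row loses at most 1.
    Independent rows among the first n then index [P], since a vector of [U] supported there is a
    vanishing combination of them. *)
Lemma exists_pivots (U : 'M[K]_(n + 1)) : exists2 P : {set 'I_n}, (n - \rank U <= #|P|)%N & pivots U P.
Proof.
pose C := cokermx U; pose Cu := usubmx C.
pose f := maxrankfun Cu.
have f_inj : injective f := @maxrankfun_inj _ _ _ Cu.
exists [set f i | i : 'I_(\rank Cu)].
  rewrite card_imset // card_ord.
  have : (\rank C <= \rank Cu + \rank (dsubmx C))%N.
    rewrite -[C in X in (X <= _)%N]vsubmxK -addsmxE.
    by case: (mxrank_adds_leqif (usubmx C) (dsubmx C)).
  rewrite mxrank_coker; have := rank_leq_row (dsubmx C); lia.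
move=> y y0; rewrite submxE -/C -[C]vsubmxK mul_row_col mul0mx addr0 => /eqP yC.
pose y' : 'rV_(\rank Cu) := \row_t y 0 (f t).
have y'0 : y' = 0.
  have /row_free_inj : row_free (rowsub f Cu) by apply: maxrowsub_free.
  apply; rewrite mul0mx -yC; apply/rowP => j; rewrite !mxE.
  rewrite [RHS](bigID (mem [set f i | i : 'I_(\rank Cu)])) /= [X in _ + X]big1 ?addr0 => [|i /y0 ->]; last by rewrite mul0r.
  rewrite big_imset /=; last by move=> ? ? _ _; apply: f_inj.
  by apply: eq_bigr => t _; rewrite !mxE.
apply/rowP => i; rewrite mxE.
case: (boolP (i \in [set f i | i : 'I_(\rank Cu)])) => [/imsetP [t _ ->]|/y0 //].
by move/rowP/(_ t): y'0; rewrite !mxE.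
Qed.

Lemma sgnb_inj : injective (sgnb K).
Proof.
have h : 1 != -1 :> K by rewrite eq_sym -subr_eq0 -opprD oppr_eq0 -(natrD _ 1 1) pnatr_eq0.
by move=> [] [] //= /eqP; rewrite /sgnb ?(negbTE h) // eq_sym (negbTE h).
Qed.

Section Fiber.
Variables (U : 'M[K]_(n + 1)) (J X0 P : {set 'I_n}).
Hypothesis pivP : pivots U P.
Hypothesis PJ : P \subset ~: J.
Let F := [set Y in resample_class J X0 | (relation Y <= U)%MS].
Let B := ~: J :\: P.

Let F_inj : {in F &, injective (fun Y => Y :&: B)}.
Proof.
move=> Y1 Y2; rewrite !inE => /andP[/andP[_ /eqP Y1J] Y1U] /andP[/andP[_ /eqP Y2J] Y2U] e.
have agree i : i \notin P -> (i \in Y1) = (i \in Y2).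
  move=> iP; have [iJ|iJ] := boolP (i \in J).
    by move/setP/(_ i): (etrans Y1J (esym Y2J)); rewrite !inE iJ !andbT.
  by move/setP/(_ i): e; rewrite !inE iJ iP !andbT.
have := pivP (y := (\row_j sgnb K (j \in Y1)) - (\row_j sgnb K (j \in Y2))).
have -> : (row_mx (\row_j sgnb K (j \in Y1) - \row_j sgnb K (j \in Y2)) 0 <= U)%MS.
  have NY2U : (- relation Y2 <= U)%MS by rewrite eqmx_opp.
  by have := addmx_sub Y1U NY2U; rewrite /relation opp_row_mx add_row_mx subrr.
move=> /(_ _ isT) h; apply/setP => i.
have : (\row_j sgnb K (j \in Y1) - \row_j sgnb K (j \in Y2)) 0 i = (0 : 'rV[K]_n) 0 i.
  by rewrite h // => j /agree jE; rewrite !mxE jE subrr.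
by rewrite !mxE => /eqP; rewrite subr_eq0 => /eqP /sgnb_inj.
Qed.

Let card_setDJ Y : Y \in resample_class J X0 -> #|Y :\: J| = #|X0 :\: J|.
Proof. by rewrite inE => /andP[/eqP c /eqP e]; rewrite !cardsD c e. Qed.

(** By the pivot property [Y] is determined by its trace on [B], the resampled non-pivot
    coordinates. Once j = |Y :&: P| is fixed, that trace has prescribed size. *)
Lemma card_fiber_le :
  (#|F| <= \sum_(j < #|P|.+1) 'C(#|~: J| - #|P|, #|X0 :\: J| - j))%N.
Proof.
rewrite -sum1_card (partition_big (fun Y => inord #|Y :&: P| : 'I_#|P|.+1) predT) //=.
apply: leq_sum => j _.
have cB : #|B| = (#|~: J| - #|P|)%N by rewrite cardsD (setIidPr PJ).
rewrite -cB -cards_draws sum1_card.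
pose Fj := [set Y in F | inord #|Y :&: P| == j].
have -> : #|[pred Y | (Y \in F) && (inord #|Y :&: P| == j)]| = #|Fj|.
  by apply: eq_card => Y; rewrite !inE.
have inj : {in Fj &, injective (fun Y => Y :&: B)}.
  by move=> Y1 Y2 /setIdP[h1 _] /setIdP[h2 _]; exact: F_inj.
rewrite -(card_in_imset inj); apply: subset_leq_card; apply/subsetP => Z /imsetP[Y].
move=> /setIdP[/setIdP[Yc _] /eqP Yj] ->; rewrite inE subsetIr /= -(card_setDJ Yc).
have jE : nat_of_ord j = #|Y :&: P|.
  by rewrite -Yj inordK // ltnS subset_leq_card // subsetIr.
rewrite jE -(cardsID P (Y :\: J)).
have -> : (Y :\: J) :&: P = Y :&: P.
  apply/setP => i; rewrite !inE; case: (boolP (i \in P)) => iP; rewrite ?andbF ?andbT //.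
  by have := subsetP PJ i iP; rewrite inE => ->.
rewrite addKn; apply/eqP/eq_card => i; rewrite !inE.
by case: (i \in Y); rewrite ?andbF ?andbT //= andbC.
Qed.

Lemma card_cls_ge : ('C(#|~: J|, #|X0 :\: J|) <= #|resample_class J X0|)%N.
Proof.
rewrite -cards_draws.
set Dr := [set Z : {set 'I_n} | _ & _].
have inj : {in Dr &, injective (fun Z => (X0 :&: J) :|: Z)}.
  move=> Z1 Z2; rewrite !inE => /andP[s1 _] /andP[s2 _] /setP e; apply/setP => i.
  have [iJ|iJ] := boolP (i \in J).
    have h (Z : {set 'I_n}) : Z \subset ~: J -> (i \in Z) = false.
      by move=> s; apply/negP => /(subsetP s); rewrite inE iJ.
    by rewrite !h.
  by have := e i; rewrite !inE (negbTE iJ) !andbF.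
rewrite -(card_in_imset inj); apply: subset_leq_card; apply/subsetP => Y /imsetP[Z].
rewrite inE => /andP[s /eqP c] ->; rewrite inE; apply/andP; split.
  rewrite cardsU; have -> : (X0 :&: J) :&: Z = set0.
    apply/setP => i; rewrite !inE; apply/negP => /andP[/andP[_ iJ] /(subsetP s)].
    by rewrite inE iJ.
  by rewrite cards0 subn0 c cardsID.
apply/eqP/setP => i; rewrite !inE; case: (boolP (i \in J)) => iJ; rewrite ?andbF ?andbT //.
case: (boolP (i \in Z)) => [/(subsetP s)|_]; first by rewrite inE iJ.
by rewrite orbF.
Qed.

(** [bin_ratio] applies to each of the |P| + 1 terms of [card_fiber_le], compared with the size of
    the whole class. *)
Lemma fiber_prob (eta : R) : 0 <= eta -> eta <= 1 ->
  eta * #|~: J|%:R + #|P|%:R <= #|X0 :\: J|%:R ->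
  eta * #|~: J|%:R + #|P|%:R <= #|~: J :\: X0|%:R ->
  #|F|%:R / #|resample_class J X0|%:R <= (#|P|.+1)%:R * (1 - eta) ^+ #|P| :> R.
Proof.
move=> eta0 eta1 h1 h2.
rewrite ler_pdivrMr ?ltr0n ?card_cls_gt0 //.
have hc : #|~: J|%:R - #|X0 :\: J|%:R = #|~: J :\: X0|%:R :> R.
  rewrite -(cardsID X0 (~: J)) natrD -addrA [X in _ + X]addrC addrA.
  have -> : ~: J :&: X0 = X0 :\: J by apply/setP => i; rewrite !inE.
  by rewrite subrr add0r.
apply: (@le_trans _ _ (\sum_(j < #|P|.+1) (1 - eta) ^+ #|P| * #|resample_class J X0|%:R)).
  apply: le_trans (_ : _ <= (\sum_(j < #|P|.+1) 'C(#|~: J| - #|P|, #|X0 :\: J| - j))%:R) _.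
    by rewrite ler_nat; exact: card_fiber_le.
  rewrite natr_sum; apply: ler_sum => j _.
  apply: le_trans (bin_ratio eta1 eta0 _ h1 _) _.
  - by rewrite -ltnS.
  - by rewrite hc.
  apply: ler_wpM2l; first by rewrite exprn_ge0 // subr_ge0.
  by rewrite ler_nat; exact: card_cls_ge.
by rewrite sumr_const card_ord -[X in X <= _]mulr_natl mulrA.
Qed.
End Fiber.
End Odlyzko.

Lemma ler_sub_twice (R : realFieldType) (x y z w p : R) :
  x <= y + (z + w) -> y <= p -> z <= p -> x - 2 * p <= w.
Proof. lra. Qed.

Lemma leq_sub_succ (l n r r' : nat) : (l < n - r)%N -> (r' <= r.+1)%N -> (l <= n - r')%N.
Proof. lia. Qed.

Lemma mxrank_adds_row (F : fieldType) m n (U : 'M[F]_(m, n)) (x : 'rV[F]_n) :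
  (\rank (U + x)%MS <= (\rank U).+1)%N.
Proof.
rewrite -[X in (_ <= X)%N]addn1; apply: leq_trans (mxrank_adds_leqif U x).1 _.
by rewrite leq_add2l rank_leq_row.
Qed.

(** * Independence of the correlated pair modulo known relations *)

Section OdlyzkoLayers.
Variables (R : realType) (n a L M : nat) (eta : R).
Local Notation K := R[i].
Local Notation S := (layers 'I_n a).
Local Notation relation := (@relation K n).
Hypothesis eta0 : 0 <= eta.
Hypothesis eta1 : eta <= 3^-1.
Hypothesis LM : eta * n%:R + L%:R <= M%:R.
Hypothesis Ma : (4 * M <= a)%N.
Hypothesis Mna : (4 * M <= n - a.+1)%N.
Implicit Types (J X Y Z P : {set 'I_n}) (U : 'M[K]_(n + 1)).
Let kap := 1 - eta.

Let eta_le1 : eta <= 1. Proof. move: eta1; lra. Qed.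
Let kap0 : 0 <= kap. Proof. by rewrite subr_ge0. Qed.
Let kapL0 : 0 <= kap ^+ L. Proof. by rewrite exprn_ge0. Qed.

Let LleM : (L <= M)%N.
Proof.
have : 0 <= eta * n%:R by rewrite mulr_ge0.
by rewrite -(ler_nat R); move: LM; lra.
Qed.

Lemma exists_subset_card (P : {set 'I_n}) l : (l <= #|P|)%N -> exists2 P' : {set 'I_n}, P' \subset P & #|P'| = l.
Proof.
move=> lP; have : (0 < #|[set P' : {set 'I_n} | P' \subset P & #|P'| == l]|)%N.
  by rewrite cards_draws bin_gt0.
by case/card_gt0P => P'; rewrite inE => /andP[s /eqP e]; exists P'.
Qed.

Lemma layers_card X : X \in S -> (4 * M <= #|X|)%N /\ (4 * M <= #|~: X|)%N.
Proof.
rewrite !inE => h; have := cardsC X; rewrite card_ord => e.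
by case/orP: h => /eqP c; move: Ma Mna; split; lia.
Qed.

Lemma fiber_prob_le U J X P : pivots U P -> (L <= #|P :\: J|)%N ->
  (M <= #|X :\: J|)%N -> (M <= #|~: X :\: J|)%N ->
  #|[set Y in resample_class J X | (relation Y <= U)%MS]|%:R / #|resample_class J X|%:R <= L.+1%:R * kap ^+ L :> R.
Proof.
move=> pP LP h1 h2; have [P' sP cP] := exists_subset_card LP.
have Jn : eta * #|~: J|%:R + L%:R <= M%:R.
  apply: le_trans LM; rewrite lerD2r; apply: ler_wpM2l => //.
  by rewrite ler_nat -[X in (_ <= X)%N]card_ord max_card.
rewrite /kap -cP; apply: fiber_prob => //.
- by apply: pivots_sub pP; apply: subset_trans sP (subsetDl _ _).
- by apply: subset_trans sP _; rewrite setDE subsetIr.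
- by rewrite cP; apply: le_trans Jn _; rewrite ler_nat.
rewrite cP; apply: le_trans Jn _; rewrite ler_nat.
by have -> : ~: J :\: X = ~: X :\: J by apply/setP => i; rewrite !inE andbC.
Qed.

Lemma card_rv_sub U : (L <= n - \rank U)%N ->
  #|[set X in S | (relation X <= U)%MS]|%:R <= L.+1%:R * kap ^+ L * #|S|%:R :> R.
Proof.
move=> rU; have [P cP pP] := exists_pivots U.
have hk k : k \in [:: a; a.+1] ->
  #|[set X in slice 'I_n k | (relation X <= U)%MS]|%:R <= L.+1%:R * kap ^+ L * #|slice 'I_n k|%:R :> R.
  move=> kin; case: (set_0Vmem (slice 'I_n k)) => [e|[X0 X0k]].
    have -> : [set X in slice 'I_n k | (relation X <= U)%MS] = set0.
      by apply/setP => X; rewrite inE e !inE.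
    by rewrite cards0 mulr_ge0 // mulr_ge0.
  have X0S : X0 \in S by move: kin X0k; rewrite !inE => /orP[]/eqP -> ->; rewrite ?orbT.
  have [h1 h2] := layers_card X0S.
  (* With nothing retained, resampling is uniform on the layer, so the unconditional bound is the
     case J empty of the fiber bound. *)
  have cE : resample_class set0 X0 = slice 'I_n k.
    by apply/setP => Y; move: X0k; rewrite !inE => /eqP ->; rewrite !setI0 eqxx andbT.
  have := @fiber_prob_le U set0 X0 P pP; rewrite !setD0 cE.
  move=> /(_ (leq_trans rU cP)); rewrite ler_pdivrMr; last first.
    by rewrite ltr0n; apply/card_gt0P; exists X0.
  have le4 (m : nat) : (4 * M <= m)%N -> (M <= m)%N by apply: leq_trans; apply: leq_pmull.
  by move=> h; apply: h; apply: le4.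
have -> : [set X in S | (relation X <= U)%MS] =
  [set X in slice 'I_n a | (relation X <= U)%MS] :|: [set X in slice 'I_n a.+1 | (relation X <= U)%MS].
  by apply/setP => X; rewrite in_setU !in_set -andb_orl.
apply: le_trans (_ : _ <= (#|[set X in slice 'I_n a | (relation X <= U)%MS]| + #|[set X in slice 'I_n a.+1 | (relation X <= U)%MS]|)%:R) _.
  by rewrite ler_nat leq_card_setU.
rewrite natrD card_layers -!card_slice natrD mulrDr.
by apply: lerD; apply: hk; rewrite !inE eqxx ?orbT.
Qed.

(** Exceptional [J] leave fewer than L pivots, or fewer than M points of [X] or of its complement,
    to be resampled. Each kind has proportion at most (2/3)^L <= kap^L, since eta <= 1/3 and L <= M;
    with the factor L + 1 for the other [J] this makes L + 4. *)
Lemma sum_fiber_prob_le U X : X \in S -> (4 * L <= n - \rank U)%N ->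
  \sum_J #|[set Y in resample_class J X | (relation Y <= U)%MS]|%:R / #|resample_class J X|%:R
  <= (2 ^ n)%:R * ((L + 4)%:R * kap ^+ L) :> R.
Proof.
move=> XS rU; have [P cP pP] := exists_pivots U.
have [h1 h2] := layers_card XS.
pose bad (Z : {set 'I_n}) l : R := \sum_J ((#|Z :\: J| < l)%N)%:R.
have badE (Z : {set 'I_n}) l : (4 * l <= #|Z|)%N -> bad Z l <= (2 ^ n)%:R * (2 / 3) ^+ l.
  move=> h; have := setD_tail R h; rewrite card_ord; apply: le_trans.
  rewrite -sum1_card natr_sum [X in _ <= X]big_mkcond /=.
  by apply: ler_sum => J _; rewrite inE; case: (_ < _)%N.
have b1 := badE P L (leq_trans rU cP).
have b2 := badE X M h1; have b3 := badE (~: X) M h2.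
have q1 : (2 / 3) ^+ M <= kap ^+ L :> R.
  apply: le_trans (_ : _ <= (2 / 3) ^+ L) _; first by apply: ler_wiXn2l => //; lra.
  by apply: lerXn2r; rewrite ?nnegrE // /kap; move: eta1; lra.
have q2 : (2 / 3) ^+ L <= kap ^+ L :> R.
  by apply: lerXn2r; rewrite ?nnegrE // /kap; move: eta1; lra.
have N0 : 0 <= (2 ^ n)%:R :> R by rewrite ler0n.
have {}b1 := le_trans b1 (ler_wpM2l N0 q2).
have {}b2 := le_trans b2 (ler_wpM2l N0 q1).
have {}b3 := le_trans b3 (ler_wpM2l N0 q1).
apply: (@le_trans _ _ ((2 ^ n)%:R * (L.+1%:R * kap ^+ L) + bad P L + bad X M + bad (~: X) M)).
  have -> : (2 ^ n)%:R * (L.+1%:R * kap ^+ L) = \sum_(J : {set 'I_n}) (L.+1%:R * kap ^+ L) :> R.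
    rewrite sumr_const mulr_natl; congr (_ *+ _).
    by rewrite -[n in LHS]card_ord -card_set_setT cardsT.
  rewrite /bad -!big_split /=; apply: ler_sum => J _.
  have p0 : 0 <= L.+1%:R * kap ^+ L by rewrite mulr_ge0.
  have le1 : #|[set Y in resample_class J X | (relation Y <= U)%MS]|%:R / #|resample_class J X|%:R <= 1 :> R.
    rewrite ler_pdivrMr ?ltr0n ?card_cls_gt0 // mul1r ler_nat.
    by apply/subset_leq_card/subsetP => Y /setIdP[].
  have big (x y z w : R) : 0 <= x -> 0 <= y -> 0 <= z -> 0 <= w -> 1 <= y + z + w -> 1 <= x + y + z + w by lra.
  case: (ltnP #|P :\: J| L) => c1.
    by apply: le_trans le1 _; apply: big => //=; case: (_ < _)%N; case: (_ < _)%N => /=; lra.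
  case: (ltnP #|X :\: J| M) => c2.
    by apply: le_trans le1 _; apply: big => //=; case: (_ < _)%N => /=; lra.
  case: (ltnP #|~: X :\: J| M) => c3.
    by apply: le_trans le1 _; apply: big => //=; lra.
  rewrite !addr0; exact: fiber_prob_le pP c1 c2 c3.
rewrite -[X in _ <= _ * (X * _)]/((L + 4)%:R) natrD -natr1; nra.
Qed.

Lemma wt_rv_sub U : (L <= n - \rank U)%N ->
  \sum_(X in S | (relation X <= U)%MS) \sum_(Y in S) resample_wt R a X Y <= L.+1%:R * kap ^+ L.
Proof.
move=> rU; apply: (@le_trans _ _ (\sum_(X in [set X in S | (relation X <= U)%MS]) (#|S|%:R)^-1)).
  rewrite [X in _ <= X](eq_bigl (fun X => (X \in S) && (relation X <= U)%MS)); last by move=> X; rewrite inE.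
  by apply: ler_sum => X _; apply: sum_wt_row_le.
rewrite sumr_const -[_ *+ _]mulr_natl.
case: (posnP #|S|) => [e|S0]; first by rewrite e invr0 mulr0 mulr_ge0.
by rewrite ler_pdivrMr ?ltr0n //; apply: card_rv_sub.
Qed.

Lemma wt_row_rv_sub U X : X \in S -> (4 * L <= n - \rank U)%N ->
  \sum_(Y in S | (relation Y <= U)%MS) resample_wt R a X Y <= (#|S|%:R)^-1 * ((L + 4)%:R * kap ^+ L).
Proof.
move=> XS rU.
have -> : \sum_(Y in S | (relation Y <= U)%MS) resample_wt R a X Y = \sum_(Y in [set Y in S | (relation Y <= U)%MS]) resample_wt R a X Y.
  by apply: eq_bigl => Y; rewrite in_set.
rewrite sum_wt invfM -mulrA; apply: ler_wpM2l; first by rewrite invr_ge0.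
rewrite card_ord ler_pdivrMl ?ltr0n ?expn_gt0 //.
apply: le_trans (sum_fiber_prob_le XS rU); apply: ler_sum => J _.
apply: ler_wpM2r; first by rewrite invr_ge0.
rewrite ler_nat; apply/subset_leq_card/subsetP => Y.
by rewrite !inE => /andP[/andP[_ ->] ->].
Qed.

(** From the correlated gain subtract the pairs with [X] already in [U] and those with [Y] in
    [U + relation X]. The codimension hypothesis is strict because the second space may have rank
    one larger. *)
Lemma gain_extend (eps1 : R) (v : 'I_n -> K) (c : K) (A : {set {set 'I_n}}) U :
  0 < eps1 -> eps1 * n%:R <= a%:R -> eps1 * n%:R <= n%:R - a%:R - 1 ->
  (exists i, v i != 0) -> (4 * L < n - \rank U)%N ->
  A = [set X in S | \sum_i sgnb K (i \in X) * v i == c] ->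
  (1 + gain eps1) * (#|A|%:R / #|S|%:R) ^+ 2 - 2 * ((L + 4)%:R * kap ^+ L) <=
  \sum_(X in A | ~~ (relation X <= U)%MS)
    \sum_(Y in A | ~~ (relation Y <= U + relation X)%MS) resample_wt R a X Y.
Proof.
move=> e0 e1 e2 v0 rU AE.
have AS X : X \in A -> X \in S by rewrite AE inE => /andP[].
have card_n : n%:R = #|'I_n|%:R :> R by rewrite card_ord.
rewrite card_n in e1 e2.
have G : (1 + gain eps1) * (#|A|%:R / #|S|%:R) ^+ 2 <= \sum_(X in A) \sum_(Y in A) resample_wt R a X Y.
  rewrite AE; exact: (@layers_gain R 'I_n a eps1 e0 e1 e2 v c v0).
have p0 : 0 <= (L + 4)%:R * kap ^+ L by rewrite mulr_ge0.
rewrite (bigID (fun X => (relation X <= U)%MS)) /= in G.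
have B1 : \sum_(X in A | (relation X <= U)%MS) \sum_(Y in A) resample_wt R a X Y <= (L + 4)%:R * kap ^+ L.
  apply: (@le_trans _ _ (L.+1%:R * kap ^+ L)); last first.
    by apply: ler_wpM2r => //; rewrite ler_nat -addn1 leq_add2l.
  apply: le_trans (wt_rv_sub (U := U) _); last exact: leq_trans (leq_pmull _ _) (ltnW rU).
  rewrite [X in X <= _]big_mkcond [X in _ <= X]big_mkcond /=; apply: ler_sum => X _.
  have w0 : 0 <= \sum_(Y in S) resample_wt R a X Y by apply: sumr_ge0 => Y _; apply: wt_ge0.
  case: (boolP (X \in A)) => [/AS -> /=|_ /=]; last by case: ifP.
  case: ifP => // _; rewrite [X in X <= _]big_mkcond [X in _ <= X]big_mkcond /=.
  apply: ler_sum => Y _; case: (boolP (Y \in A)) => [/AS -> //|_].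
  by case: ifP => // _; apply: wt_ge0.
have B2 : \sum_(X in A | ~~ (relation X <= U)%MS) \sum_(Y in A | (relation Y <= U + relation X)%MS) resample_wt R a X Y
    <= (L + 4)%:R * kap ^+ L.
  apply: (@le_trans _ _ (\sum_(X in S) (#|S|%:R)^-1 * ((L + 4)%:R * kap ^+ L))); last first.
    rewrite sumr_const -[_ *+ _]mulr_natl mulrA.
    case: (eqVneq (#|S|%:R : R) 0) => [->|h]; first by rewrite !mul0r.
    by rewrite divff // mul1r.
  rewrite [X in X <= _]big_mkcond [X in _ <= X]big_mkcond /=; apply: ler_sum => X _.
  case: (boolP (X \in A)) => [/AS XS /=|_ /=]; last first.
    by case: ifP => // _; rewrite mulr_ge0 ?invr_ge0.
  rewrite XS; case: ifP => // _; last by rewrite mulr_ge0 ?invr_ge0.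
  apply: le_trans (wt_row_rv_sub (U := (U + relation X)%MS) XS _); last first.
    exact: leq_sub_succ rU (mxrank_adds_row _ _).
  rewrite [X in X <= _]big_mkcond [X in _ <= X]big_mkcond /=; apply: ler_sum => Y _.
  case: (boolP (Y \in A)) => [/AS -> //|_ /=].
  by case: ifP => // _; apply: wt_ge0.
have e : \sum_(X in A | ~~ (relation X <= U)%MS) \sum_(Y in A) resample_wt R a X Y =
  \sum_(X in A | ~~ (relation X <= U)%MS) \sum_(Y in A | (relation Y <= U + relation X)%MS) resample_wt R a X Y +
  \sum_(X in A | ~~ (relation X <= U)%MS) \sum_(Y in A | ~~ (relation Y <= U + relation X)%MS) resample_wt R a X Y.
  rewrite -big_split /=; apply: eq_bigr => X _.
  by rewrite (bigID (fun Y => (relation Y <= U + relation X)%MS)).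
rewrite e in G.
exact: ler_sub_twice G B1 B2.
Qed.
End OdlyzkoLayers.

(** * Union bound over relation spaces *)

Lemma prod_family (I T : finType) (F : I -> {set T}) :
  #|[set M : {ffun I -> T} | [forall i, M i \in F i]]| = (\prod_i #|F i|)%N.
Proof.
rewrite cardsE -[LHS]/(#|family (fun i => mem (F i))|) card_family.
by rewrite foldrE big_map big_enum.
Qed.

(** Fix the coordinates outside [Z], which [red] records: [phi] becomes a fixed family of
    predicates, and the coordinates in [Z] satisfy theirs independently. *)
Lemma card_independent (R : realFieldType) (I T : finType) (S : {set T}) (Z : {set I})
    (phi : {ffun I -> T} -> I -> T -> bool) (q : R) :
  (0 < #|S|)%N -> 0 <= q ->
  (forall M M' : {ffun I -> T}, (forall i, i \notin Z -> M i = M' i) -> phi M = phi M') ->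
  (forall M i, i \in Z -> #|[set y in S | phi M i y]|%:R <= q) ->
  #|[set M : {ffun I -> T} | [forall i, M i \in S] && [forall i in Z, phi M i (M i)]]|%:R
  <= q ^+ #|Z| * #|S|%:R ^+ #|~: Z| :> R.
Proof.
case/card_gt0P => s0 s0S q0 phiZ hq.
pose red (M : {ffun I -> T}) := [ffun i => if i \in Z then s0 else M i].
pose Fr i : {set T} := if i \in Z then [set s0] else S.
set E := [set M | _ & _].
have redE M : M \in E -> red M \in [set M : {ffun I -> T} | [forall i, M i \in Fr i]].
  rewrite !inE => /andP[/forallP h _]; apply/forallP => i.
  by rewrite ffunE /Fr; case: ifP => // _; rewrite inE.
rewrite -sum1_card (partition_big red (mem [set M : {ffun I -> T} | [forall i, M i \in Fr i]])) //=.
rewrite natr_sum; apply: (@le_trans _ _ (\sum_(M0 in [set M : {ffun I -> T} | [forall i, M i \in Fr i]]) q ^+ #|Z|)); last first.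
  rewrite sumr_const -[_ *+ _]mulr_natr; apply: ler_wpM2l; first exact: exprn_ge0.
  rewrite prod_family -natrX ler_nat.
  rewrite (bigID (mem Z)) /= big1 => [|i iZ]; last by rewrite /Fr iZ cards1.
  rewrite mul1n (eq_bigr (fun=> #|S|)) => [|i /negbTE iZ]; last by rewrite /Fr iZ.
  rewrite (eq_bigl (mem (~: Z))) => [|i]; last by rewrite !inE.
  by rewrite prod_nat_const.
apply: ler_sum => M0 _; rewrite sum1_card.
pose Ff i : {set T} := if i \in Z then [set y in S | phi M0 i y] else [set M0 i].
apply: (@le_trans _ _ (#|[set M : {ffun I -> T} | [forall i, M i \in Ff i]]|%:R)).
  rewrite ler_nat; apply/subset_leq_card/subsetP => M; rewrite unfold_in => /andP[ME /eqP eM].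
  move: ME; rewrite !inE => /andP[/forallP hS /forallP hZ].
  have agree i : i \notin Z -> M i = M0 i by move=> /negbTE iZ; rewrite -eM ffunE iZ.
  apply/forallP => i; rewrite /Ff; case: ifP => iZ; last by rewrite inE agree // iZ.
  by rewrite inE hS -(phiZ _ _ agree); apply: (implyP (hZ i)).
rewrite prod_family natr_prod (bigID (mem Z)) /= [X in _ * X]big1 ?mulr1; last first.
  by move=> i /negbTE iZ; rewrite /Ff iZ cards1.
rewrite -prodr_const; apply: ler_prod => i iZ; rewrite ler0n /= /Ff iZ.
exact: hq.
Qed.

Lemma card_bigcup_le (I T : finType) (P : pred I) (B : I -> {set T}) :
  (#|\bigcup_(i | P i) B i| <= \sum_(i | P i) #|B i|)%N.
Proof.
elim/big_rec2: _ => [|i m X _ le_mX]; first by rewrite cards0.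
by apply: leq_trans (leq_card_setU _ _) _; rewrite leq_add2l.
Qed.

(** A maximal independent subfamily of the vectors [g i], i in [Q], has at most d members; it is
    padded to length d with an arbitrary element of [Q]. *)
Lemma exists_spanning_family (K : fieldType) (I : finType) (Q : {set I}) d (g : I -> 'cV[K]_d) :
  (0 < #|Q|)%N ->
  exists2 f : {ffun 'I_d -> I}, (forall t, f t \in Q) &
    forall b : 'rV[K]_d, (forall t, b *m g (f t) = 0) -> forall i, i \in Q -> b *m g i = 0.
Proof.
move=> Q0.
pose G : 'M[K]_(#|Q|, d) := \matrix_(i, j) g (enum_val i) j 0.
pose h := maxrankfun G.
have rd : (\rank G <= d)%N by apply: rank_leq_col.
pose f : {ffun 'I_d -> I} := [ffun t : 'I_d => if insub (val t) is Some t' then enum_val (h (t' : 'I_(\rank G))) else enum_val (Ordinal Q0)].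
exists f => [t|b bf i iQ].
  by rewrite ffunE; case: insubP => [t' _ _|_]; apply: enum_valP.
have rowG j : b *m (row j G)^T = b *m g (enum_val j).
  by congr (_ *m _); apply/colP => x; rewrite !mxE.
have sub : (rowsub h G <= kermx b^T)%MS.
  apply/row_subP => t; rewrite row_rowsub sub_kermx -trmx_eq0 trmx_mul trmxK rowG.
  have := bf (widen_ord rd t); rewrite ffunE /=.
  case: insubP => [t' _ tt'|]; last by rewrite ltn_ord.
  have -> : t' = t by apply: val_inj.
  by move=> ->.
have GK : (G <= kermx b^T)%MS by rewrite -(eq_maxrowsub G).
have := submx_trans (row_sub (enum_rank_in iQ i) G) GK.
rewrite sub_kermx -trmx_eq0 trmx_mul trmxK rowG enum_rankK_in // => /eqP.
by [].
Qed.

Lemma mxrank_adds_row_eq (F : fieldType) m n (U : 'M[F]_(m, n)) (x : 'rV[F]_n) :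
  ~~ (x <= U)%MS -> \rank (U + x)%MS = (\rank U).+1.
Proof.
move=> xU; apply/eqP; rewrite eqn_leq mxrank_adds_row /=.
have : (U < U + x)%MS by rewrite ltmxE addsmxSl addsmx_sub submx_refl xU.
exact: rank_ltmx.
Qed.

(** * Row families with a null vector of prescribed concentration *)

Section NullVectors.
Variables (R : realType) (n a : nat) (Ir : finType) (Q : {set Ir}).
Local Notation K := R[i].
Local Notation S := (layers 'I_n a).
Local Notation relation := (@relation K n).
Variables (F : Ir -> 'I_n -> K) (lo hi : R).
Implicit Types (X Y : {set 'I_n}) (U : 'M[K]_(n + 1)) (M : {ffun Ir -> {set 'I_n}}).

Definition hits (v : 'I_n -> K) (c : K) := [set X in S | \sum_i sgnb K (i \in X) * v i == c].

(** The largest atom rho(v) lies in [lo, hi], and [c] is a witness for the lower bound. *)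
Definition level (v : 'I_n -> K) (c : K) : Prop :=
  [/\ exists i, v i != 0, lo <= #|hits v c|%:R / #|S|%:R &
      forall c', #|hits v c'|%:R / #|S|%:R <= hi].

Definition homogenized (v : 'I_n -> K) (c : K) : 'cV[K]_(n + 1) := col_mx (\col_i v i) (- c)%:M.

Definition row_dot X (i : Ir) (v : 'I_n -> K) := \sum_j (sgnb K (j \in X) + F i j) * v j.

Definition bad_rows U M : Prop :=
  exists v c, [/\ level v c, U *m homogenized v c = 0 & forall i, i \in Q -> row_dot (M i) i v = 0].

Definition configs : {set {ffun Ir -> {set 'I_n}}} := [set M : {ffun Ir -> {set 'I_n}} | [forall i, M i \in S]].

Definition bad_set U := [set M in configs | `[< bad_rows U M >]].

Lemma rv_ext X v c : (relation X *m homogenized v c == 0) = (\sum_i sgnb K (i \in X) * v i == c).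
Proof.
rewrite /relation /homogenized mul_row_col mul1mx -[in RHS]subr_eq0.
have -> : (\row_j sgnb K (j \in X)) *m (\col_i v i) + (- c)%:M = (\sum_i sgnb K (i \in X) * v i - c)%:M.
  apply/matrixP => i j; rewrite !ord1 !mxE eqxx !mulr1n; congr (_ + _).
  by apply: eq_bigr => x _; rewrite !mxE.
apply/eqP/eqP => [/matrixP/(_ 0 0)|->]; last exact: raddf0.
by rewrite !mxE eqxx mulr1n.
Qed.

(* Averaging over the random pair: every bad M survives for a proportion at least
   gam of the pairs (X, Y) that enlarge the relation space U. *)
Lemma bad_set_step U (gam Emax : R) r : 0 < gam -> 0 <= Emax -> \rank U = r ->
  (forall v c, level v c -> gam <=
     \sum_(X in hits v c | ~~ (relation X <= U)%MS)
       \sum_(Y in hits v c | ~~ (relation Y <= U + relation X)%MS) resample_wt R a X Y) ->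
  (forall U', \rank U' = r.+2 -> #|bad_set U'|%:R <= Emax) ->
  #|bad_set U|%:R <= Emax / gam.
Proof.
move=> g0 E0 rU hg hE; rewrite ler_pdivlMr // mulrC mulr_natr -sumr_const.
pose ok X Y := ~~ (relation X <= U)%MS && ~~ (relation Y <= U + relation X)%MS.
apply: (@le_trans _ _ (\sum_(M in bad_set U) \sum_(X in S) \sum_(Y in S)
   (if ok X Y && (M \in bad_set (U + relation X + relation Y)%MS) then resample_wt R a X Y else 0))).
  apply: ler_sum => M /setIdP[Mc /asboolP[v [c [lev Uvc hQ]]]].
  apply: le_trans (hg v c lev) _.
  rewrite [X in X <= _]big_mkcond [X in _ <= X]big_mkcond /=; apply: ler_sum => X _.
  have ge0 : 0 <= \sum_(Y in S) (if ok X Y && (M \in bad_set (U + relation X + relation Y)%MS) then resample_wt R a X Y else 0).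
    by apply: sumr_ge0 => Y _; case: ifP => // _; apply: wt_ge0.
  case: ifP => [/andP[]|_]; last by case: ifP.
  rewrite inE => /andP[XS XA] rX; rewrite XS.
  rewrite [X in X <= _]big_mkcond [X in _ <= X]big_mkcond /=; apply: ler_sum => Y _.
  case: ifP => [/andP[]|_]; last first.
    by case: ifP => // _; case: ifP => // _; apply: wt_ge0.
  rewrite inE => /andP[YS YA] rY; rewrite YS /ok rX rY /=.
  have -> : M \in bad_set (U + relation X + relation Y)%MS; last by [].
  rewrite in_set Mc; apply/asboolP; exists v, c; split=> //.
  apply/eqP; rewrite -sub_kermx !addsmx_sub !sub_kermx Uvc eqxx /=.
  by rewrite !rv_ext XA YA.
rewrite exchange_big /=.
apply: (@le_trans _ _ (\sum_(X in S) \sum_(Y in S) resample_wt R a X Y * Emax)); last first.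
  under eq_bigr do rewrite -mulr_suml.
  by rewrite -mulr_suml ler_piMl ?sum_wt_le1.
apply: ler_sum => X _; rewrite exchange_big /=; apply: ler_sum => Y _.
have w0 := wt_ge0 R a X Y.
case: (boolP (ok X Y)) => [/andP[rX rY]|_] /=; last by rewrite big1 //; exact: mulr_ge0.
rewrite -big_mkcondr /= sumr_const -[_ *+ _]mulr_natr; apply: ler_wpM2l => //.
apply: le_trans (hE (U + relation X + relation Y)%MS _); last by rewrite -rU !mxrank_adds_row_eq.
by rewrite ler_nat; apply/subset_leq_card/subsetP => M; rewrite unfold_in => /andP[].
Qed.

(** Iterate the averaging step T times from the zero space, each time raising the rank by 2. With t
    > 0 steps left the rank is 2 (T - t), so the codimension in n + 1 still exceeds D and the pair
    estimate applies. *)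
Lemma bad_set_rec (gam Emax : R) (T D : nat) : 0 < gam -> 0 <= Emax -> (D + T.*2 = n.+1)%N ->
  (forall v c U, level v c -> (D < n.+1 - \rank U)%N -> gam <=
     \sum_(X in hits v c | ~~ (relation X <= U)%MS)
       \sum_(Y in hits v c | ~~ (relation Y <= U + relation X)%MS) resample_wt R a X Y) ->
  (forall U, \rank U = T.*2 -> #|bad_set U|%:R <= Emax) ->
  #|bad_set 0|%:R <= Emax / gam ^+ T.
Proof.
move=> g0 E0 DT hg hE.
suff rec t U : (t <= T)%N -> \rank U = (T - t).*2 -> #|bad_set U|%:R <= Emax / gam ^+ t.
  by apply: rec => //; rewrite subnn mxrank0.
elim: t U => [|t IH] U tT rU; first by rewrite expr0 divr1 hE // rU subn0.
rewrite exprSr invfM mulrA; apply: (bad_set_step g0 _ rU).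
- by rewrite divr_ge0 // exprn_ge0 // ltW.
- move=> v c lev; apply: hg => //; rewrite rU; move: DT tT; clear; lia.
by move=> U' rU'; apply: IH; [exact: ltnW | rewrite rU'; move: tT; clear; lia].
Qed.

Hypothesis S0 : (0 < #|S|)%N.

(** The deterministic row only translates the sign sum: the event is that x.v equals -f.v, one of
    the atoms bounded by [hi]. *)
Lemma card_dot_eq0 v c i : level v c -> #|[set X in S | row_dot X i v == 0]|%:R <= hi * #|S|%:R.
Proof.
case=> _ _ /(_ (- \sum_j F i j * v j)); rewrite ler_pdivrMr ?ltr0n //.
congr (_%:R <= _); apply: eq_card => X; rewrite !inE; congr (_ && _).
rewrite /row_dot; under [in RHS]eq_bigr do rewrite mulrDl.
by rewrite big_split /= addr_eq0.
Qed.

Let dotE X i v c : (homogenized v c)^T *m col_mx (\col_j (sgnb K (j \in X) + F i j)) (0 : 'cV_1) = (row_dot X i v)%:M.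
Proof.
rewrite /homogenized tr_col_mx mul_row_col mulmx0 addr0; apply/matrixP => x y.
rewrite !ord1 !mxE eqxx mulr1n; apply: eq_bigr => j _.
by rewrite !mxE mulrC.
Qed.

(* The d rows f t already determine the null vector w within the solutions of U, and the
   remaining rows are independent of it. *)
Lemma card_bad_set_le U d : (d + \rank U = n.+1)%N -> 0 <= hi <= 1 -> (0 < #|Q|)%N ->
  #|bad_set U|%:R <= #|Q|%:R ^+ d * hi ^+ (#|Q| - d) * #|S|%:R ^+ #|Ir|.
Proof.
move=> dU /andP[hi0 hi1] Q0.
have rd : \rank (kermx U^T) = d by rewrite mxrank_ker mxrank_tr; move: dU; clear; lia.
rewrite -{}rd {dU}; set d' := \rank _.
pose W : 'M[K]_(d', n + 1) := row_base (kermx U^T).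
pose g M i := W *m col_mx (\col_j (sgnb K (j \in M i) + F i j)) (0 : 'cV_1).
pose P (f : {ffun 'I_d' -> Ir}) (h : {ffun 'I_d' -> {set 'I_n}}) (p : ('I_n -> K) * K) :=
  [/\ level p.1 p.2, U *m homogenized p.1 p.2 = 0 & forall t, row_dot (h t) (f t) p.1 = 0].
(* The null vector is chosen from the d rows indexed by [f] alone, so the rows in [Z f] stay
   independent of it. *)
pose w f h : ('I_n -> K) * K :=
  if pselect (exists p, P f h p) is left e then projT1 (cid e) else (fun=> 0, 0).
have wP f h p : P f h p -> P f h (w f h).
  move=> Pp; rewrite /w; case: pselect => [e|]; first exact: (projT2 (cid e)).
  by case; exists p.
pose at_f (f : {ffun 'I_d' -> Ir}) (M : {ffun Ir -> {set 'I_n}}) : {ffun 'I_d' -> {set 'I_n}} := [ffun t => M (f t)].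
pose Z (f : {ffun 'I_d' -> Ir}) := Q :\: [set f t | t : 'I_d'].
pose phi f (M : {ffun Ir -> {set 'I_n}}) i y :=
  `[< P f (at_f f M) (w f (at_f f M)) >] && (row_dot y i (w f (at_f f M)).1 == 0).
pose Bf f := [set M : {ffun Ir -> {set 'I_n}} | [forall i, M i \in S] && [forall i in Z f, phi f M i (M i)]].
pose Fs : {set {ffun 'I_d' -> Ir}} := [set f : {ffun 'I_d' -> Ir} | [forall t, f t \in Q]].
have cover : bad_set U \subset \bigcup_(f in Fs) Bf f.
  apply/subsetP => M /setIdP[Mc /asboolP[v [c [lev Uvc hQ]]]].
  have [f fQ hf] := exists_spanning_family (g M) Q0.
  apply/bigcupP; exists f; first by rewrite inE; apply/forallP.
  have Pvc : P f (at_f f M) (v, c) by split=> // t; rewrite ffunE hQ.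
  have Pw := wP _ _ _ Pvc.
  rewrite inE; apply/andP; split; first by move: Mc; rewrite inE.
  apply/forall_inP => i /setDP[iQ _]; apply/andP; split; first exact/asboolP.
  (* The chosen vector may differ from [v], but it solves [U] and vanishes on the rows [f t]. In
     coordinates b with respect to the basis [W] of solutions, the spanning property extends this to
     all rows in [Q]. *)
  case: (Pw) => _ Uw hw; move: Uw hw; set v' := (w _ _).1; set c' := (w _ _).2 => Uw hw.
  have /submxP[b bE] : ((homogenized v' c')^T <= W)%MS.
    by rewrite eq_row_base sub_kermx -trmx_mul Uw trmx0.
  have gE j : b *m g M j = (row_dot (M j) j v')%:M by rewrite /g mulmxA -bE dotE.
  have := hf b _ i iQ; rewrite gE => h.
  have /matrixP/(_ 0 0) : (row_dot (M i) i v')%:M = 0 :> 'M[K]_1.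
    by apply: h => t; rewrite gE; have := hw t; rewrite ffunE => ->; exact: raddf0.
  by rewrite !mxE eqxx mulr1n => ->.
apply: (@le_trans _ _ (\sum_(f in Fs) #|Bf f|%:R)).
  rewrite -natr_sum ler_nat; apply: leq_trans (subset_leq_card cover) _.
  exact: card_bigcup_le.
have cFs : #|Fs| = (#|Q| ^ d')%N.
  by rewrite (prod_family (fun=> Q)) prod_nat_const card_ord.
rewrite -natrX -cFs -mulrA mulr_natl -sumr_const; apply: ler_sum => f _.
have cZ : (#|Q| - d' <= #|Z f|)%N.
  rewrite cardsD leq_sub2l //; apply: leq_trans (subset_leq_card (subsetIr _ _)) _.
  by apply: leq_trans (leq_imset_card _ _) _; rewrite card_ord.
apply: le_trans (card_independent (q := hi * #|S|%:R) S0 _ _ _) _.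
- by rewrite mulr_ge0.
- move=> M M' agree; have atE : at_f f M = at_f f M'.
    apply/ffunP => t; rewrite !ffunE; apply: agree.
    by rewrite in_setD negb_and negbK imset_f.
  by apply/funext => i; apply/funext => y; rewrite /phi atE.
- move=> M i _; case: (asboolP (P f (at_f f M) (w f (at_f f M)))) => [Pw|nP]; last first.
    have -> : [set y in S | phi f M i y] = set0; last by rewrite cards0 mulr_ge0.
    by apply/setP => y; rewrite in_set in_set0 /phi (introF (asboolP _) nP) andbF.
  case: (Pw) => lev _ _; apply: le_trans (card_dot_eq0 i lev).
  by rewrite ler_nat; apply/subset_leq_card/subsetP => y; rewrite !inE => /andP[-> /andP[_ ->]].
rewrite exprMn -mulrA -exprD cardsC; apply: ler_wpM2r; first exact: exprn_ge0.
exact: ler_wiXn2l.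
Qed.
End NullVectors.

Lemma geometric_bracket (R : realFieldType) (r x : R) (J : nat) :
  r ^+ J < x -> x <= 1 -> exists2 j, (j < J)%N & r ^+ j.+1 <= x <= r ^+ j.
Proof.
elim: J => [|J IH]; first by rewrite expr0 => /lt_le_trans h /h; rewrite ltxx.
move=> h x1; have [le|lt] := leP x (r ^+ J).
  by exists J => //; rewrite ltW.
by have [j jJ hj] := IH lt x1; exists j => //; apply: ltnW.
Qed.

Lemma exists_null_vector (K : fieldType) m n (A : 'M[K]_(m, n)) : (m < n)%N ->
  exists2 v : 'I_n -> K, (exists i, v i != 0) & forall i, \sum_j A i j * v j = 0.
Proof.
move=> mn.
have : kermx A^T != 0.
  by rewrite -mxrank_eq0 mxrank_ker mxrank_tr subn_eq0 -ltnNge (leq_ltn_trans (rank_leq_row A)).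
case/rowV0Pn => u /sub_kermxP uA u0; exists (fun j => u 0 j).
  by case/rV0Pn: u0 => j uj; exists j.
move=> i; move/rowP/(_ i): uA; rewrite !mxE => e; rewrite -[RHS]e.
by apply: eq_bigr => j _; rewrite !mxE mulrC.
Qed.

(** As 2 T = (k - D) + 2, the powers of hi = r^j cancel except for hi^(-2), which is at most
    r^(-2J); the T gained factors leave r^(2T). *)
Lemma rich_bound (R : realFieldType) (r x : R) (k D T J j : nat) :
  0 < r -> r <= 1 -> (j < J)%N -> (D <= k)%N -> (D + T.*2 = k.+2)%N -> 0 <= x ->
  x * (r ^+ j) ^+ (k - D) / ((r ^+ j / r) ^+ 2) ^+ T <= x * r ^+ T.*2 / r ^+ J.*2.
Proof.
move=> r0 r1 jJ Dk DT x0.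
have h0 : 0 < r ^+ j by rewrite exprn_gt0.
have -> : ((r ^+ j / r) ^+ 2) ^+ T = (r ^+ j) ^+ (k - D) * (r ^+ j) ^+ 2 / r ^+ T.*2.
  rewrite -exprM mul2n expr_div_n; congr (_ / _); rewrite -exprD; congr (_ ^+ _).
  move: DT Dk; clear; lia.
have hk : 0 < (r ^+ j) ^+ (k - D) by rewrite exprn_gt0.
have -> : x * (r ^+ j) ^+ (k - D) / ((r ^+ j) ^+ (k - D) * (r ^+ j) ^+ 2 / r ^+ T.*2)
  = x * r ^+ T.*2 / (r ^+ j) ^+ 2.
  by field; rewrite !gt_eqF // exprn_gt0.
apply: ler_wpM2l; first by rewrite mulr_ge0 // exprn_ge0 // ltW.
rewrite lef_pV2 ?posrE ?exprn_gt0 // -exprM.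
by apply: ler_wiXn2l => //; [exact: ltW | rewrite muln2 leq_double ltnW].
Qed.

(** Half of the gain g absorbs the error e. The other half pays for r^4: one factor r^2 for the
    width of the bracket [lo, hi], one for the improvement of hi^2 to (hi / r)^2. *)
Lemma gain_margin (R : realFieldType) (r g e x lo hi : R) : 0 < r -> 0 < g ->
  1 <= (1 + g / 2) * r ^+ 4 -> 0 <= lo -> hi = lo / r -> lo <= x ->
  e <= g / 2 * lo ^+ 2 ->
  (hi / r) ^+ 2 <= (1 + g) * x ^+ 2 - e.
Proof.
move=> r0 g0 hr lo0 -> lox he.
have -> : (lo / r / r) ^+ 2 = lo ^+ 2 / r ^+ 4 by field; rewrite gt_eqF.
apply: (@le_trans _ _ ((1 + g / 2) * lo ^+ 2)).
  rewrite ler_pdivrMr ?exprn_gt0 // mulrAC; rewrite ler_peMl ?sqr_ge0 //.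
have : (1 + g) * lo ^+ 2 <= (1 + g) * x ^+ 2.
  by apply: ler_wpM2l; [lra | apply: lerXn2r; rewrite ?nnegrE // (le_trans lo0)].
lra.
Qed.

(** * The event for row 0 with all parameters fixed *)

Section FiniteBound.
Variables (R : realType) (k a L M J D T : nat) (eps1 eta r : R).
Local Notation n := k.+1.
Local Notation K := R[i].
Local Notation S := (layers 'I_n a).
Variable F : 'I_n -> 'I_n -> K.
Hypotheses (eta0 : 0 <= eta) (eta1 : eta <= 3^-1).
Hypotheses (LM : eta * n%:R + L%:R <= M%:R) (Ma : (4 * M <= a)%N) (Mna : (4 * M <= n - a.+1)%N).
Hypotheses (e0 : 0 < eps1) (e1 : eps1 * n%:R <= a%:R) (e2 : eps1 * n%:R <= n%:R - a%:R - 1).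
Hypotheses (LD : (4 * L < D)%N) (Dk : (D <= k)%N) (DT : (D + T.*2 = k.+2)%N).
Hypotheses (r0 : 0 < r) (r1 : r <= 1) (rgain : 1 <= (1 + gain eps1 / 2) * r ^+ 4).
Hypothesis small : 2 * ((L + 4)%:R * (1 - eta) ^+ L) <= gain eps1 / 2 * r ^+ J.*2.

Local Notation dotF := (row_dot (n := n) F).
Definition other_rows : {set 'I_n} := ~: [set 0].

(** Span membership in dual form: whatever annihilates the other rows annihilates row 0. *)
Definition row0_event : {set {ffun 'I_n -> {set 'I_n}}} :=
  [set M in configs n a 'I_n |
     `[< forall v, (forall i, i \in other_rows -> dotF (M i) i v = 0) -> dotF (M 0) 0 v = 0 >]].

Let S0 : (0 < #|S|)%N.
Proof.
have cn : n%:R = #|'I_n|%:R :> R by rewrite card_ord.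
by apply: (@card_layers_gt0 R _ a eps1) => //; rewrite -cn.
Qed.

Let SS : 0 < #|S|%:R :> R. Proof. by rewrite ltr0n. Qed.

Let cQ : #|other_rows| = k.
Proof. by rewrite cardsCs setCK cards1 card_ord subn1. Qed.

Let poor (v : 'I_n -> K) := forall c, #|hits a v c|%:R / #|S|%:R <= r ^+ J.

Let null_vec (Mc : {ffun 'I_n -> {set 'I_n}}) (v : 'I_n -> K) :=
  (exists i, v i != 0) /\ (forall i, i \in other_rows -> dotF (Mc i) i v = 0).

(** [bad_set_rec] on the bracket [r^(j+1), r^j] with gam = (hi / r)^2; the final space of
    codimension D is handled by [card_bad_set_le]. *)
Lemma card_rich_level j : (j < J)%N ->
  #|bad_set a other_rows F (r ^+ j.+1) (r ^+ j) 0|%:R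
  <= k%:R ^+ D * r ^+ T.*2 / r ^+ J.*2 * #|S|%:R ^+ n :> R.
Proof.
move=> jJ.
have hi01 : 0 <= r ^+ j <= 1 by rewrite exprn_ge0 ?exprn_ile1 // ltW.
have hi0 : 0 < r ^+ j by rewrite exprn_gt0.
have g0 : 0 < (r ^+ j / r) ^+ 2 by rewrite exprn_gt0 // divr_gt0.
pose Emax : R := k%:R ^+ D * (r ^+ j) ^+ (k - D) * #|S|%:R ^+ n.
have E0 : 0 <= Emax.
  by apply: mulr_ge0; [apply: mulr_ge0|]; apply: exprn_ge0; rewrite ?ler0n ?ltW.
have k0 : (0 < #|other_rows|)%N by rewrite cQ; apply: leq_trans Dk; apply: leq_trans LD.
have := @bad_set_rec R n a 'I_n other_rows F (r ^+ j.+1) (r ^+ j) _ Emax T D g0 E0 DT.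
have step (v : 'I_n -> K) (c : K) (U : 'M[K]_(n + 1)) : level a (r ^+ j.+1) (r ^+ j) v c -> (D < n.+1 - \rank U)%N ->
   (r ^+ j / r) ^+ 2 <= \sum_(X in hits a v c | ~~ (relation K X <= U)%MS)
       \sum_(Y in hits a v c | ~~ (relation K Y <= U + relation K X)%MS) resample_wt R a X Y.
  case=> v0 lo _ rU.
  have rU' : (4 * L < n - \rank U)%N by move: LD rU; clear; lia.
  apply: le_trans (gain_extend eta0 eta1 LM Ma Mna e0 e1 e2 v0 rU' (erefl (hits a v c))).
  apply: (gain_margin (lo := r ^+ j.+1)) => //.
  - by apply: gain_gt0.
  - by rewrite exprn_ge0 // ltW.
  - by rewrite exprSr mulfK // gt_eqF.
  apply: le_trans small _; apply: ler_wpM2l; first by rewrite divr_ge0 // ltW // gain_gt0.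
  by rewrite -exprM muln2; apply: ler_wiXn2l => //; [exact: ltW | rewrite leq_double].
move=> /(_ step) h; apply: le_trans (h _) _.
  move=> U rU; have dU : (D + \rank U = n.+1)%N by rewrite rU.
  by have := card_bad_set_le F (r ^+ j.+1) S0 dU hi01 k0; rewrite cQ card_ord.
rewrite /Emax mulrAC; apply: ler_wpM2r; first by rewrite exprn_ge0.
by apply: rich_bound => //; apply: exprn_ge0; exact: ler0n.
Qed.

(** A poor null vector is selected from the other rows only. Row 0 is independent of it, and must
    hit a single atom, of mass at most r^J. *)
Lemma card_poor_event :
  #|[set Mc in row0_event | `[< exists2 v, null_vec Mc v & poor v >]]|%:R
  <= r ^+ J * #|S|%:R ^+ n :> R.
Proof.
pose P (Mc : {ffun 'I_n -> {set 'I_n}}) v := null_vec Mc v /\ poor v.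
pose w Mc : 'I_n -> K := if pselect (exists v, P Mc v) is left e then projT1 (cid e) else fun=> 0.
have wP Mc v : P Mc v -> P Mc (w Mc).
  move=> Pv; rewrite /w; case: pselect => [e|]; first exact: (projT2 (cid e)).
  by case; exists v.
pose phi (Mc : {ffun 'I_n -> {set 'I_n}}) (i : 'I_n) y :=
  `[< P Mc (w Mc) >] && (dotF y 0 (w Mc) == 0).
have rJ0 : 0 <= r ^+ J by rewrite exprn_ge0 // ltW.
have := @card_independent R 'I_n _ S [set 0] phi (r ^+ J * #|S|%:R) S0.
rewrite mulr_ge0 // => /(_ isT) h.
have {h} := h _ _; rewrite cards1 expr1 -/other_rows cQ -mulrA -exprS => h.
apply: le_trans (h _ _).
- rewrite ler_nat; apply/subset_leq_card/subsetP => Mc /setIdP[/setIdP[Mconf /asboolP ev]] /asboolP[v nv pv].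
  rewrite inE; apply/andP; split; first by move: Mconf; rewrite inE.
  apply/forall_inP => i; rewrite inE => /eqP ->.
  have Pw := wP Mc v (conj nv pv).
  apply/andP; split; first exact/asboolP.
  by apply/eqP/ev; case: Pw => -[_].
- move=> M1 M2 agree.
  have PE v : P M1 v = P M2 v.
    have e i : i \in other_rows -> M1 i = M2 i by rewrite !inE => i0; apply: agree; rewrite inE.
    by apply/propext; split=> -[[v0 h1] h2]; (split=> //; split=> // i iQ); [rewrite -e ?h1 | rewrite e ?h1].
  have wE : w M1 = w M2 by rewrite /w (_ : P M1 = P M2) //; apply/funext.
  by apply/funext => i; apply/funext => y; rewrite /phi wE PE.
- move=> Mc i _; case: (asboolP (P Mc (w Mc))) => [[_ pv]|nP]; last first.
    have -> : [set y in S | phi Mc i y] = set0; last by rewrite cards0 mulr_ge0.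
    by apply/setP => y; rewrite in_set in_set0 /phi (introF (asboolP _) nP) andbF.
  have := pv (- \sum_j F 0 j * w Mc j); rewrite ler_pdivrMr //; apply: le_trans.
  rewrite ler_nat; apply/subset_leq_card/subsetP => y; rewrite !inE => /andP[-> /andP[_]] /=.
  have -> : dotF y 0 (w Mc) = \sum_j sgnb K (j \in y) * w Mc j + \sum_j F 0 j * w Mc j.
    by rewrite -big_split; apply: eq_bigr => j _; rewrite mulrDl.
  by rewrite addr_eq0.
Qed.

(** Only the finitely many values taken on the layers have hits, so the maximum may be taken over
    [X] in S. *)
Lemma exists_max_hits (v : 'I_n -> K) : exists c, forall c', (#|hits a v c'| <= #|hits a v c|)%N.
Proof.
have [X0 X0S] : exists X, X \in S by apply/card_gt0P.
pose val (X : {set 'I_n}) := \sum_i sgnb K (i \in X) * v i.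
pose X1 := [arg max_(X > X0 in S) #|hits a v (val X)|].
exists (val X1) => c'.
rewrite /X1; case: arg_maxnP => // X XS hX.
case: (set_0Vmem (hits a v c')) => [->|[Y]]; first by rewrite cards0.
by rewrite inE => /andP[YS /eqP <-]; apply: hX.
Qed.

(** The k other rows in dimension k + 1 have a common nonzero null vector. Either some null vector
    is poor, or this one has its largest atom in one of the J brackets between r^J and 1. *)
Lemma card_row0_event :
  #|row0_event|%:R <= (r ^+ J + J%:R * (k%:R ^+ D * r ^+ T.*2 / r ^+ J.*2)) * #|S|%:R ^+ n :> R.
Proof.
pose B (j : 'I_J) := bad_set a other_rows F (r ^+ j.+1) (r ^+ j) 0.
have cover : row0_event \subset
   [set Mc in row0_event | `[< exists2 v, null_vec Mc v & poor v >]] :|: \bigcup_(j in [set: 'I_J]) B j.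
  apply/subsetP => Mc Mev; rewrite in_setU -implyNb; apply/implyP.
  rewrite in_set Mev /= => /asboolP noPoor.
  have [v v0 hv] := @exists_null_vector K k n (\matrix_(i, j) (sgnb K (j \in Mc (lift 0 i)) + F (lift 0 i) j)) (ltnSn k).
  have nv : null_vec Mc v.
    split=> // i; rewrite !inE; case: (unliftP 0 i) => [i' -> _|->]; last by rewrite eqxx.
    by rewrite -[RHS](hv i'); apply: eq_bigr => j _; rewrite mxE.
  have [c hc] := exists_max_hits v.
  have ch : r ^+ J < #|hits a v c|%:R / #|S|%:R.
    rewrite ltNge; apply/negP => le; apply: noPoor; exists v => // c'.
    by apply: le_trans le; rewrite ler_pM2r ?invr_gt0 // ler_nat.
  have le1 : #|hits a v c|%:R / #|S|%:R <= 1 :> R.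
    rewrite ler_pdivrMr // mul1r ler_nat; apply/subset_leq_card/subsetP => X.
    by rewrite inE => /andP[].
  have [j jJ /andP[h1 h2]] := geometric_bracket ch le1.
  apply/bigcupP; exists (Ordinal jJ); rewrite ?inE //.
  apply/andP; split; first by move: Mev; rewrite inE => /andP[]; rewrite inE.
  apply/asboolP; exists v, c; split; [split=> //|by rewrite mul0mx|by case: nv].
  by move=> c'; apply: le_trans h2; rewrite ler_pM2r ?invr_gt0 // ler_nat.
apply: (@le_trans _ _ (#|[set Mc in row0_event | `[< exists2 v, null_vec Mc v & poor v >]]|%:R
   + \sum_(j in [set: 'I_J]) #|B j|%:R)).
  rewrite -natr_sum -natrD ler_nat; apply: leq_trans (subset_leq_card cover) _.
  by apply: leq_trans (leq_card_setU _ _) _; rewrite leq_add2l card_bigcup_le.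
rewrite mulrDl; apply: lerD; first exact: card_poor_event.
apply: le_trans (ler_sum _ (fun j _ => card_rich_level (ltn_ord j))) _.
by rewrite sumr_const cardsT card_ord -[X in _ <= X]mulrA [X in _ <= X]mulr_natl lexx.
Qed.
End FiniteBound.

(** * Choice of parameters *)

Section PolyExp.
Variable R : realType.

(** Induction on b: split r^h into two powers of the square root of r, one for each part of the
    polynomial. The linear case is Bernoulli's inequality for 1 / s. *)
Lemma poly_exp_bounded (b : nat) (r : R) : 0 < r < 1 ->
  exists2 C : R, 0 < C & forall h : nat, h.+1%:R ^+ b * r ^+ h <= C.
Proof.
have linear (s : R) : 0 < s < 1 -> exists2 C : R, 0 < C & forall h : nat, h.+1%:R * s ^+ h <= C.
  case/andP => s0 s1; pose x := s^-1 - 1.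
  have x0 : 0 < x by rewrite subr_gt0 invf_gt1.
  exists (1 + x^-1); first by rewrite addr_gt0 // invr_gt0.
  move=> h; have sh : 0 < s ^+ h by rewrite exprn_gt0.
  rewrite -ler_pdivlMr // -exprVn.
  have bern : 1 + h%:R * x <= s^-1 ^+ h.
    have -> : s^-1 = 1 + x by rewrite /x addrC subrK.
    elim: h {sh} => [|h IH]; first by rewrite mul0r addr0 expr0.
    rewrite exprS; apply: le_trans (_ : _ <= (1 + x) * (1 + h%:R * x)) _.
      have : 0 <= h%:R * x * x by rewrite !mulr_ge0 // ltW.
      rewrite -natr1; lra.
    by apply: ler_wpM2l => //; rewrite addr_ge0 // ltW.
  apply: le_trans (_ : _ <= (1 + x^-1) * (1 + h%:R * x)) _.
    have -> : (1 + x^-1) * (1 + h%:R * x) = h%:R + 1 + (h%:R * x + x^-1).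
      by field; rewrite gt_eqF.
    by rewrite natr1 lerDl addr_ge0 ?mulr_ge0 ?invr_ge0 // ltW.
  by apply: ler_wpM2l bern; rewrite addr_ge0 // invr_ge0 ltW.
elim: b r => [|b IH] r r01.
  exists 1 => // h; case/andP: r01 => r0 r1.
  by rewrite expr0 mul1r exprn_ile1 // ltW.
case/andP: r01 => r0 r1; pose s := Num.sqrt r.
have s2 : s ^+ 2 = r by rewrite sqr_sqrtr // ltW.
have s0 : 0 < s by rewrite sqrtr_gt0.
have s01 : 0 < s < 1 by rewrite s0 -[1]sqrtr1 ltr_sqrt.
have [C1 C10 h1] := IH s s01; have [C2 C20 h2] := linear s s01.
exists (C1 * C2) => [|h]; first exact: mulr_gt0.
have -> : h.+1%:R ^+ b.+1 * r ^+ h = (h.+1%:R ^+ b * s ^+ h) * (h.+1%:R * s ^+ h).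
  by rewrite -s2 -exprM mulnC exprM exprS; ring.
by apply: ler_pM => //; rewrite mulr_ge0 ?exprn_ge0 // ltW.
Qed.

(** Bound the expression with exponent b + 1 and divide by h + 1. *)
Lemma poly_exp_small (b : nat) (r d : R) : 0 < r < 1 -> 0 < d ->
  exists h0 : nat, forall h, (h0 <= h)%N -> h.+1%:R ^+ b * r ^+ h <= d.
Proof.
move=> r01 d0; have [C C0 hC] := poly_exp_bounded b.+1 r01.
exists (Num.Def.archi_bound (C / d)) => h hh.
have hp : 0 < h.+1%:R :> R by rewrite ltr0Sn.
rewrite -(ler_pM2l hp) mulrA -exprS; apply: le_trans (hC h) _.
rewrite -ler_pdivrMr //; apply: ltW.
apply: lt_le_trans (archi_boundP (divr_ge0 (ltW C0) (ltW d0))) _.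
by rewrite ler_nat; apply: leq_trans hh _.
Qed.
End PolyExp.

Lemma exists_sqrt (n : nat) : exists h, (h ^ 2 <= n < h.+1 ^ 2)%N.
Proof.
elim: n => [|n [h /andP[h1 h2]]]; first by exists 0%N.
have [lt|ge] := ltnP n.+1 (h.+1 ^ 2); first by exists h; rewrite (leq_trans h1).
exists h.+1; rewrite ge /=; apply: leq_ltn_trans h2 _.
by rewrite ltn_exp2r.
Qed.

Section Asymptotics.
Variables (R : realType) (eps1 : R).
Hypotheses (e0 : 0 < eps1) (e1 : eps1 <= 2^-1).

Lemma gain_le1 : gain eps1 <= 1.
Proof.
rewrite /gain ler_pdivrMr // mul1r; apply: (@le_trans _ _ 1); last by rewrite ler1n.
by apply: exprn_ile1; [exact: ltW | move: e1; lra].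
Qed.

Lemma rate_margin (g : R) : 0 < g -> g <= 1 -> 1 <= (1 + g / 2) * (1 - g / 16) ^+ 4.
Proof.
move=> g0 g1.
have b : 1 - g / 4 <= (1 - g / 16) ^+ 4.
  have sq : 1 - g / 8 <= (1 - g / 16) ^+ 2 by have := sqr_ge0 (g / 16); rewrite !expr2; lra.
  have -> : (1 - g / 16) ^+ 4 = ((1 - g / 16) ^+ 2) ^+ 2 by rewrite -exprM.
  apply: (@le_trans _ _ ((1 - g / 8) ^+ 2)); last by apply: lerXn2r => //; rewrite nnegrE; lra.
  by have := sqr_ge0 (g / 8); rewrite !expr2; lra.
apply: (@le_trans _ _ ((1 + g / 2) * (1 - g / 4))); last by apply: ler_wpM2l => //; lra.
nra.
Qed.

(** With h about sqrt n and D <= e h, the factor k^D is at most (h + 1)^(2 e h), while 2 T + e h >=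
    h^2. After multiplying out, both sides are bounded by or equal to h-th powers, and the
    hypothesis compares the bases. *)
Lemma final_exponents (r : R) (h k n D T e : nat) : 0 < r -> r <= 1 -> (k < n)%N ->
  (h ^ 2 <= n)%N -> (n < h.+1 ^ 2)%N -> (D <= e * h)%N -> (D + T.*2 = n.+1)%N ->
  h.+1%:R ^+ (2 * e + 1) * r ^+ h <= r ^+ (e + 3) ->
  h%:R * (k%:R ^+ D * r ^+ T.*2 / r ^+ h.*2) <= r ^+ h.
Proof.
move=> r0 r1 kn hn nh De DT hr.
have rp m : 0 < r ^+ m by rewrite exprn_gt0.
rewrite mulrA ler_pdivrMr //.
have h1 : 1 <= h.+1%:R :> R by rewrite ler1n.
have hh : h%:R <= h.+1%:R ^+ h :> R.
  by rewrite -natrX ler_nat; apply: ltnW; apply: leq_trans (ltn_expl h (ltnSn 1)) _; case: (h) => // m; rewrite leq_exp2r.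
have kD : k%:R ^+ D <= h.+1%:R ^+ (2 * (e * h)) :> R.
  apply: (@le_trans _ _ ((h.+1%:R ^+ 2) ^+ D)).
    apply: lerXn2r; rewrite ?nnegrE ?exprn_ge0 ?ler0n //.
    by rewrite -natrX ler_nat; apply: ltnW; apply: ltn_trans kn nh.
  by rewrite -exprM; apply: ler_weXn2l => //; rewrite leq_mul2l.
have rT : r ^+ T.*2 * r ^+ (e * h) <= r ^+ (h ^ 2).
  rewrite -exprD; apply: ler_wiXn2l => //; first exact: ltW.
  by move: De DT hn; clear; lia.
rewrite -(ler_pM2r (rp (e * h)%N)).
apply: (@le_trans _ _ (h.+1%:R ^+ h * (h.+1%:R ^+ (2 * (e * h)) * r ^+ (h ^ 2)))).
  rewrite -!mulrA; apply: ler_pM => //; first by rewrite mulr_ge0 ?exprn_ge0 ?mulr_ge0 ?exprn_ge0 // ltW.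
  by apply: ler_pM => //; rewrite ?exprn_ge0 ?mulr_ge0 ?exprn_ge0 // ltW.
have -> : h.+1%:R ^+ h * (h.+1%:R ^+ (2 * (e * h)) * r ^+ (h ^ 2)) =
   (h.+1%:R ^+ (2 * e + 1) * r ^+ h) ^+ h.
  by rewrite mulrA -exprD exprMn -!exprM mulnn; congr (_ ^+ _ * _); clear; lia.
have -> : r ^+ h * r ^+ h.*2 * r ^+ (e * h) = (r ^+ (e + 3)) ^+ h.
  by rewrite -exprM -!exprD; congr (_ ^+ _); clear; lia.
by apply: lerXn2r; rewrite ?nnegrE ?mulr_ge0 ?exprn_ge0 // ltW.
Qed.

(** For n large, J = h about sqrt n, L and D are of order h, and T is nearly n / 2. The resulting
    bound 2 r^h decays faster than any power of n. *)
Lemma row0_event_decay : exists2 r : R, 0 < r < 1 & exists h0 : nat,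
  forall (h k a : nat) (F : 'I_k.+1 -> 'I_k.+1 -> R[i]), (h0 <= h)%N ->
  (h ^ 2 <= k.+1)%N -> (k.+1 < h.+1 ^ 2)%N ->
  eps1 * k.+1%:R <= a%:R -> eps1 * k.+1%:R <= k.+1%:R - a%:R - 1 ->
  #|row0_event a F|%:R <= 2 * r ^+ h * #|layers 'I_k.+1 a|%:R ^+ k.+1 :> R.
Proof.
have g0 := gain_gt0 e0; have g1 := gain_le1.
set g := gain eps1 in g0 g1 *.
pose r := 1 - g / 16.
have r01 : 0 < r < 1 by rewrite /r; apply/andP; split; lra.
have /andP[r0 /ltW r1] := r01.
(* Then 4 eta n takes a quarter of eps1 n, leaving three quarters for the term 4 L + 4 in 4 M; the
   threshold [h3] ensures that it fits. *)
pose eta := eps1 / 16; pose kap := 1 - eta.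
have k01 : 0 < kap < 1 by rewrite /kap /eta; apply/andP; split; move: e0 e1; lra.
have r30 : 0 < r ^+ 3 by rewrite exprn_gt0.
have [C hC] := poly_exp_small 0 k01 r30.
(* So that L = C h gives kap^L <= r^h r^(2h): the second factor matches the smallest bracket
   squared, the first absorbs the polynomial factor L + 4. *)
have {}hC : kap ^+ C <= r ^+ 3 by have := hC C (leqnn C); rewrite expr0 mul1r.
(* Chosen so that e h = 4 L + 2 h dominates D <= 4 L + 2. *)
pose e := (4 * C + 2)%N.
have d1 : 0 < g / (4 * (C + 4)%:R) by rewrite divr_gt0 // mulr_gt0 // ltr0n addnS.
have [h1 H1] := poly_exp_small 1 r01 d1.
have re0 : 0 < r ^+ (e + 3) by rewrite exprn_gt0.
have [h2 H2] := poly_exp_small (2 * e + 1) r01 re0.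
pose h3 := Num.Def.archi_bound ((4 + 4 * C%:R) / (3 / 4 * eps1)).
exists r => //; exists (maxn (maxn h1 h2) (maxn h3 e.+1)) => h k a F.
rewrite !geq_max => /andP[/andP[hh1 hh2] /andP[hh3 he]] hn nh ea ea'.
set n := k.+1 in hn nh ea ea' *.
pose L := (C * h)%N; pose M := ((Num.truncn (eta * n%:R)).+1 + L)%N.
have en0 : 0 <= eta * n%:R by rewrite mulr_ge0 // divr_ge0 // ltW.
have /andP[tr1 tr2] := truncn_itv en0.
have h_gt0 : (0 < h)%N by apply: leq_trans he.
have nh2 : h%:R ^+ 2 <= n%:R :> R by rewrite -natrX ler_nat.
have c0 : 0 < 3 / 4 * eps1 by move: e0; lra.
have h3b : 4 + 4 * C%:R <= 3 / 4 * eps1 * h%:R.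
  rewrite [X in _ <= X]mulrC -ler_pdivrMr //; apply: ltW.
  apply: lt_le_trans (archi_boundP _) _; last by rewrite ler_nat.
  by apply: divr_ge0; [rewrite addr_ge0 ?mulr_ge0 // ?ler0n | exact: ltW].
have M4 : 4 * M%:R <= eps1 * n%:R.
  rewrite /M natrD -natr1 /L natrM.
  have hr1 : 1 <= h%:R :> R by rewrite ler1n.
  have q1 : (4 + 4 * C%:R) * h%:R <= 3 / 4 * eps1 * h%:R ^+ 2.
    by rewrite expr2 mulrA; apply: ler_wpM2r.
  have q2 : 3 / 4 * eps1 * h%:R ^+ 2 <= 3 / 4 * eps1 * n%:R.
    by apply: ler_wpM2l => //; exact: ltW.
  move: tr1 q1 q2 hr1; rewrite /eta.
  set t := (Num.truncn _)%:R; set C' := C%:R; set h' := h%:R; set n' := n%:R; clear; lra.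
have LM : eta * n%:R + L%:R <= M%:R by rewrite /M natrD lerD2r ltW.
have Ma : (4 * M <= a)%N by rewrite -(ler_nat R) natrM; apply: le_trans M4 _.
have an : (a.+1 <= n)%N.
  rewrite -(ler_nat R) -natr1; have : 0 <= eps1 * n%:R by rewrite mulr_ge0 // ltW.
  by move: ea'; lra.
have Mna : (4 * M <= n - a.+1)%N.
  rewrite -(ler_nat R) natrM natrB // -[a.+1%:R]natr1; apply: le_trans M4 _.
  by move: ea'; lra.
have eh : (e.+1 * h <= n)%N by apply: leq_trans hn; rewrite -mulnn leq_mul2r he orbT.
have eE : (e * h = 4 * L + 2 * h)%N by rewrite /e /L mulnDl mulnA.
pose u := (n - 4 * L)%N.
(* D is the least admissible value 4 L + 1, corrected by the parity bit that makes n + 1 - D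
   even. *)
pose D := (4 * L + 1 + odd u)%N; pose T := u./2.
have uE : (odd u + T.*2 = u)%N by rewrite odd_double_half.
have odd1 : (odd u <= 1)%N by case: (odd u).
have DT : (D + T.*2 = k.+2)%N.
  rewrite /D; move: uE eh eE; rewrite /u mulSn -/n -[k.+2]/(n.+1).
  by move: (nat_of_bool _) (T.*2) (e * h)%N (4 * L)%N => x y z w; clear; lia.
have Deh : (D <= e * h)%N.
  by rewrite eE /D; move: odd1 h_gt0; clear; lia.
have Dk : (D <= k)%N.
  by move: Deh eh h_gt0; rewrite mulSn /n; move: (e * h)%N => z; clear; lia.
have LD : (4 * L < D)%N by rewrite /D -addnA -[X in (X < _)%N]addn0 ltn_add2l.
have small : 2 * ((L + 4)%:R * kap ^+ L) <= g / 2 * r ^+ h.*2.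
  have kL : kap ^+ L <= r ^+ h * r ^+ h.*2.
    have -> : r ^+ h * r ^+ h.*2 = (r ^+ 3) ^+ h.
      by rewrite -exprM -exprD; congr (_ ^+ _); clear; lia.
    rewrite /L exprM; apply: lerXn2r; rewrite ?nnegrE ?exprn_ge0 // ltW //.
    by case/andP: k01.
  have LC : (L + 4)%:R <= (C + 4)%:R * h.+1%:R :> R.
    by rewrite -natrM ler_nat /L; move: h_gt0; clear; nia.
  have q : h.+1%:R * r ^+ h * (4 * (C + 4)%:R) <= g.
    by have := H1 h hh1; rewrite expr1 ler_pdivlMr // mulr_gt0 // ltr0n addnS.
  have r2 : 0 <= r ^+ h.*2 by rewrite exprn_ge0 // ltW.
  have L0 : 0 <= (L + 4)%:R :> R by rewrite ler0n.
  have rh : 0 <= r ^+ h by rewrite exprn_ge0 // ltW.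
  apply: (@le_trans _ _ (2 * ((L + 4)%:R * (r ^+ h * r ^+ h.*2)))).
    by rewrite ler_pM2l ?ltr0n //; exact: (ler_wpM2l L0 kL).
  have -> : 2 * ((L + 4)%:R * (r ^+ h * r ^+ h.*2)) = 2 * ((L + 4)%:R * r ^+ h) * r ^+ h.*2 by ring.
  apply: ler_wpM2r => //.
  have : (L + 4)%:R * r ^+ h <= (C + 4)%:R * h.+1%:R * r ^+ h by apply: ler_wpM2r.
  move: q; set x := (C + 4)%:R; set y := h.+1%:R; set z := r ^+ h; set l := (L + 4)%:R.
  by clear; lra.
have eta0 : 0 <= eta by rewrite divr_ge0 // ltW.
have eta1 : eta <= 3^-1 by rewrite /eta; move: e1; lra.
have rg : 1 <= (1 + g / 2) * r ^+ 4 by apply: rate_margin.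
apply: le_trans (card_row0_event F eta0 eta1 LM Ma Mna e0 ea ea' LD Dk DT r0 r1 rg small) _.
apply: ler_wpM2r; first by rewrite exprn_ge0.
have -> : 2 * r ^+ h = r ^+ h + r ^+ h by ring.
rewrite lerD2l.
by apply: (final_exponents r0 r1 (ltnSn k) hn nh Deh DT); apply: H2.
Qed.
End Asymptotics.

(** * From sign matrices to families of sets *)

Section Encoding.
Variable k : nat.
Local Notation n := k.+1.

Definition plus_set (v : {ffun 'I_n -> bool}) : {set 'I_n} := [set j | v j].

Lemma plus_set_inj : injective plus_set.
Proof.
move=> v w /setP e; apply/ffunP => j.
by have := e j; rewrite !inE.
Qed.

Lemma coord_sumE (v : {ffun 'I_n -> bool}) : coord_sum v = 2 * #|plus_set v|%:Z - n%:Z.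
Proof.
have e (j : 'I_n) : sgnb int (v j) = 2 * (v j)%:Z - 1 by case: (v j).
rewrite /coord_sum (eq_bigr _ (fun j _ => e j)) sumrB -mulr_sumr sumr_const card_ord.
congr (_ * _ - _); last by rewrite natz.
rewrite -sum1_card [in RHS]big_mkcond /= -[RHS]natz natr_sum; apply: eq_bigr => j _.
by rewrite inE; case: (v j).
Qed.

Lemma Sset_layers (s : int) (a : nat) : n%:Z + s - 1 = 2 * a%:Z -> forall v : {ffun 'I_n -> bool},
  (v \in Sset n s) = (plus_set v \in layers 'I_n a).
Proof.
move=> sa v; rewrite !inE coord_sumE; move: #|_| => w; lia.
Qed.

Lemma card_Sset_layers (s : int) (a : nat) : n%:Z + s - 1 = 2 * a%:Z ->
  #|Sset n s| = #|layers 'I_n a|.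
Proof.
move=> sa; rewrite -(card_imset _ plus_set_inj); apply: eq_card => X.
apply/imsetP/idP => [[v vS ->]|XS]; first by rewrite -(Sset_layers sa).
have e : X = plus_set [ffun j => j \in X] by apply/setP => j; rewrite inE ffunE.
by exists [ffun j => j \in X]; rewrite ?(Sset_layers sa) -?e.
Qed.

Lemma Sset_nonempty (s : int) (v : {ffun 'I_n -> bool}) : v \in Sset n s -> (`|s| <= n)%N ->
  exists a : nat, n%:Z + s - 1 = 2 * a%:Z.
Proof.
rewrite inE coord_sumE => /orP[]/eqP e sn; first by exists #|plus_set v|; lia.
(* Here the coordinate sum is s + 1, and |s| <= n guarantees at least one plus sign, so the
   predecessor is not truncated. *)
by exists #|plus_set v|.-1; lia.
Qed.

Variable R : realType.

(** Encoding rows as sets is injective, and a vector null on the other rows is null on any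
    combination of them. *)
Lemma prob_event_le (s : int) (a : nat) (F : 'M[R[i]]_n) : n%:Z + s - 1 = 2 * a%:Z ->
  prob_event s F <= #|row0_event a F|%:R / #|layers 'I_n a|%:R ^+ n.
Proof.
move=> sa; rewrite /prob_event (card_Sset_layers sa) natrX.
apply: ler_wpM2r; first by rewrite invr_ge0 exprn_ge0.
pose rows (X : 'M[bool]_n) : {ffun 'I_n -> {set 'I_n}} := [ffun i => plus_set (brow X i)].
have rows_inj : injective rows.
  move=> X Y /ffunP e; apply/matrixP => i j.
  by have := e i; rewrite !ffunE => /plus_set_inj/ffunP/(_ j); rewrite !ffunE.
rewrite ler_nat -(card_imset _ rows_inj); apply/subset_leq_card/subsetP => M /imsetP[X].
rewrite inE => /andP[/forallP XS /submxP[D rowE]] ->.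
rewrite inE; apply/andP; split.
  by rewrite inE; apply/forallP => i; rewrite ffunE -(Sset_layers sa).
apply/asboolP => v hv; pose V : 'cV[R[i]]_n := \col_j v j.
have dotE i : row_dot F (rows X i) i v = (row i (pm_mx R[i] X + F) *m V) 0 0.
  by rewrite !mxE; apply: eq_bigr => j _; rewrite !mxE ffunE inE ffunE.
rewrite dotE rowE -mulmxA.
have -> : row' 0 (pm_mx R[i] X + F) *m V = 0.
  apply/colP => i; rewrite mxE [RHS]mxE -[RHS](hv (lift 0 i)).
    by rewrite dotE !mxE; apply: eq_bigr => j _; rewrite !mxE.
  by rewrite !inE.
by rewrite mulmx0 mxE.
Qed.

Lemma prob_event_le1 (s : int) (F : 'M[R[i]]_n) : prob_event s F <= 1.
Proof.
rewrite /prob_event; set A := [set X | _].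
have : (#|A| <= #|Sset n s| ^ n)%N.
  pose rows (X : 'M[bool]_n) : {ffun 'I_n -> {ffun 'I_n -> bool}} := [ffun i => brow X i].
  have rows_inj : injective rows.
    move=> X Y /ffunP e; apply/matrixP => i j.
    by have := e i; rewrite !ffunE => /ffunP/(_ j); rewrite !ffunE.
  rewrite -(card_imset _ rows_inj).
  have <- : #|[set M : {ffun 'I_n -> {ffun 'I_n -> bool}} | [forall i, M i \in Sset n s]]| = (#|Sset n s| ^ n)%N.
    by rewrite (prod_family (fun=> Sset n s)) prod_nat_const card_ord.
  apply/subset_leq_card/subsetP => M /imsetP[X].
  rewrite /A in_set => /andP[/forallP XS _] ->; rewrite inE; apply/forallP => i.
  by rewrite ffunE.
case: (posnP (#|Sset n s| ^ n)%N) => [->|S0 h]; first by rewrite invr0 mulr0 ler01.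
by rewrite ler_pdivrMr ?ltr0n // mul1r ler_nat.
Qed.

Lemma prob_event_empty (s : int) (F : 'M[R[i]]_n) : #|Sset n s| = 0%N -> prob_event s F = 0.
Proof. by move=> e; rewrite /prob_event e exp0n // invr0 mulr0. Qed.
End Encoding.

Local Open Scope complex_scope.

(* The dimension is n = k.+1 (n >= 1). *)
Theorem theorem3p4 (R : realType) (eps gamma B : R) :
  0 < eps <= 1 -> 0 < B ->
  exists K : R, forall (k : nat) (s : int) (F : 'M[R[i]]_(k.+1)),
    (`|s|%:~R <= (1 - eps) * (k.+1)%:R :> R) ->
    (forall i j, `|F i j| <= ((k.+1)%:R `^ gamma)%:C) ->
    prob_event s F <= K * (k.+1)%:R `^ (- B).
Proof.
move=> /andP[eps0 eps1] B0.
(* From 2 a = n + s - 1 >= eps n - 1 one gets a >= eps n / 3 once eps n >= 3, and likewise for n - a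
   - 1. *)
pose e := eps / 3.
have e0 : 0 < e by rewrite /e; lra.
have e1 : e <= 2^-1 by rewrite /e; lra.
have [r r01 [h1 H1]] := row0_event_decay e0 e1.
pose b := Num.Def.archi_bound B.
have Bb : B < b%:R by apply: archi_boundP; apply: ltW.
have [h2 H2] := poly_exp_small (2 * b) r01 (@ltr01 R).
pose h3 := Num.Def.archi_bound (3 / eps).
have h3E : 3 / eps < h3%:R by apply: archi_boundP; rewrite divr_ge0 // ltW.
pose h0 := maxn h1 (maxn h2 h3.+1).
(* The second term covers n < h0^2, where the probability is bounded by 1; the first covers large n,
   where 2 r^h (h + 1)^(2b) <= 2. *)
exists (2 + (h0 ^ 2)%:R ^+ b) => k s F hs _.
set n := k.+1.
have n1 : 1 <= n%:R :> R by rewrite ler1n.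
have n0 : 0 < n%:R :> R by rewrite ltr0n.
have nb0 : 0 < n%:R ^+ b :> R by rewrite exprn_gt0.
suff : prob_event s F * n%:R ^+ b <= 2 + (h0 ^ 2)%:R ^+ b.
  rewrite -ler_pdivlMr // => /le_trans; apply.
  apply: ler_wpM2l; first by rewrite addr_ge0 // exprn_ge0.
  by rewrite powRN lef_pV2 ?posrE ?powR_gt0 // -(powR_mulrn b (ltW n0)) ler_powR // ltW.
have [h /andP[hn nh]] := exists_sqrt n.
have Kge0 : 0 <= (h0 ^ 2)%:R ^+ b :> R by rewrite exprn_ge0.
have [hlt|hge] := ltnP h h0.
  apply: (@le_trans _ _ (n%:R ^+ b)).
    by rewrite ler_piMl ?prob_event_le1 // ltW.
  apply: (@le_trans _ _ ((h0 ^ 2)%:R ^+ b)); last by rewrite lerDr.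
  apply: lerXn2r; rewrite ?nnegrE // ler_nat; apply: ltnW; apply: leq_trans nh _.
  by rewrite leq_exp2r.
move: hge; rewrite !geq_max => /and3P[hh1 hh2 hh3].
(* If no sign vector has the required sum, for instance by parity, the quotient is 0 by the
   convention for division by 0. *)
have [S0|] := posnP #|Sset n s|.
  by rewrite prob_event_empty // mul0r addr_ge0.
case/card_gt0P => v vS.
have abs_s : (`|s|%N%:R : R) <= (1 - eps) * n%:R by move: hs; rewrite -abszE.
have sn : (`|s| <= n)%N.
  rewrite -(ler_nat R); apply: le_trans abs_s _.
  by rewrite ler_piMl // ?ltW //; lra.
have [a sa] := Sset_nonempty vS sn.
have n3 : 3 <= eps * n%:R.
  rewrite mulrC -ler_pdivrMr //; apply: ltW; apply: lt_le_trans h3E _.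
  rewrite ler_nat; apply: leq_trans (ltnW hh3) (leq_trans _ hn).
  by rewrite -mulnn leq_pmulr // (leq_trans _ hh3).
have saR : n%:R + s%:~R - 1 = 2 * a%:R :> R.
  by have := congr1 (fun z : int => z%:~R : R) sa; rewrite !(rmorphB, rmorphD, rmorphM) /=.
have sR : - (`|s|%N%:R) <= s%:~R :> R /\ s%:~R <= `|s|%N%:R :> R.
  have -> : `|s|%N%:R = `|s%:~R : R| by rewrite -intr_norm -abszE.
  by split; rewrite ?ler_norm // lerNl -normrN ler_norm.
case: sR => s1 s2.
have ea : e * n%:R <= a%:R by rewrite /e; lra.
have ea' : e * n%:R <= n%:R - a%:R - 1 by rewrite /e; lra.
have hbound := H1 h k a F hh1 hn nh ea ea'.
have L0 : 0 < #|layers 'I_n a|%:R ^+ n :> R.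
  rewrite exprn_gt0 // ltr0n -(card_Sset_layers sa).
  by apply/card_gt0P; exists v.
have pr : prob_event s F <= 2 * r ^+ h.
  by apply: le_trans (prob_event_le F sa) _; rewrite ler_pdivrMr.
case/andP: r01 => r0 r1.
apply: (@le_trans _ _ (2 * r ^+ h * (h.+1%:R ^+ (2 * b)))).
  apply: ler_pM => //; [|exact: ltW|].
    by rewrite /prob_event divr_ge0.
  rewrite exprM; apply: lerXn2r; rewrite ?nnegrE ?exprn_ge0 //.
  by rewrite -natrX ler_nat ltnW.
have := H2 h hh2; set x := h.+1%:R ^+ _; set y := r ^+ h => xy.
have -> : 2 * y * x = 2 * (x * y) by ring.
by apply: ler_wpDr => //; lra.
Qed.
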